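(* Let $X = \mathrm{Spec}\, A$ be a smooth affine algebraic variety over $\mathbb{R}$ without imaginary connected components, i.e. each connected component of $X$ has at least one rational point. Then the set of rational points $X(\mathbb{R})$ is Zariski dense in $X$.
   Context: A smooth affine algebraic variety over $\mathbb{R}$ means $X = \mathrm{Spec}\, A$, where $A$ is a finitely generated commutative $\mathbb{R}$-algebra whose local rings are regular. $X(\mathbb{R})$ denotes the set of rational points of $X$, i.e. the points $x \in X$ with residue field $\mathbb{R}$ (equivalently, the $\mathbb{R}$-algebra morphisms $A \to \mathbb{R}$). *)

(* Defs.v *)
From HB Require Import structures.
From mathcomp Require Import all_boot all_algebra generic_quotient ring.
From mathcomp Require Import boolp classical_sets reals topology.

Set Implicit Arguments.
Unset Strict Implicit.
Unset Printing Implicit Defensive.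

Import GRing.Theory.
Local Open Scope classical_set_scope.
Local Open Scope quotient_scope.
Local Open Scope ring_scope.

Section Ideals.
Variable A : comPzRingType.

Definition ideal (I : set A) :=
  [/\ I 0, forall a b, I a -> I b -> I (a + b) & forall a b, I b -> I (a * b)].

Definition prime_ideal (I : set A) :=
  [/\ ideal I, ~ I 1 & forall a b, I (a * b) -> I a \/ I b].

Definition maximal_ideal (I : set A) :=
  [/\ ideal I, I <> setT &
      forall J, ideal J -> I `<=` J -> J = I \/ J = setT].

Definition ideal_generated (s : seq A) : set A := smallest ideal [set` s].

Definition noetherian :=
  forall I : set A, ideal I -> exists s : seq A, ideal_generated s = I.

Definition min_number_of_generators (I : set A) (d : nat) :=
  (exists2 s : seq A, size s = d & ideal_generated s = I) /\
  (forall s : seq A, ideal_generated s = I -> (d <= size s)%N).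

(* Chains are counted by their number n of strict inclusions. *)
Definition has_prime_chain (n : nat) :=
  exists P : 'I_n.+1 -> set A,
    (forall i, prime_ideal (P i)) /\
    (forall i j : 'I_n.+1, (i < j)%N -> P i `<` P j).

Definition krull_dimension (d : nat) :=
  has_prime_chain d /\ (forall n, has_prime_chain n -> (n <= d)%N).

Definition regular_local_ring :=
  noetherian /\
  exists m : set A,
    [/\ maximal_ideal m,
        forall m' : set A, maximal_ideal m' -> m' = m &
        exists2 d, krull_dimension d & min_number_of_generators m d].

End Ideals.

Record Spec (A : comPzRingType) := {
  prime_of :> set A;
  prime_ofP : prime_ideal prime_of
}.

HB.instance Definition _ (A : comPzRingType) := gen_eqMixin (Spec A).
HB.instance Definition _ (A : comPzRingType) := gen_choiceMixin (Spec A).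

Section ZariskiTopology.
Variable A : comPzRingType.

Definition vanishing_locus (E : set A) : set (Spec A) :=
  [set x | E `<=` prime_of x].

Definition zariski_open (U : set (Spec A)) :=
  exists E : set A, U = ~` vanishing_locus E.

Lemma zariski_openT : zariski_open setT.
Proof.
exists setT; apply/seteqP; split=> // x _ /= xT.
by have [_ + _] := prime_ofP x; apply; apply: xT.
Qed.

Lemma zariski_openI : setI_closed zariski_open.
Proof.
move=> _ _ [E ->] [F ->]; exists [set a * b | a in E & b in F].
apply/seteqP; split=> x /=.
  move=> [/existsNP[a /not_implyP[Ea xa]] /existsNP[b /not_implyP[Fb xb]]] EF.
  have [_ _ /(_ a b) []//] := prime_ofP x.
  by apply: EF; exists a => //; exists b.
have [[_ _ xM] _ _] := prime_ofP x.
move=> EF; split=> xE; apply: EF => _ [a Ea [b Fb <-]].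
  by rewrite mulrC; apply: xM; apply: xE.
by apply: xM; apply: xE.
Qed.

Lemma zariski_open_bigU (I : Type) (f : I -> set (Spec A)) :
  (forall i, zariski_open (f i)) -> zariski_open (\bigcup_i f i).
Proof.
move=> /choice[E fE]; exists (\bigcup_i E i); apply/seteqP; split=> x /=.
  by move=> [i _]; rewrite fE => /= xE xEs; apply: xE => a Ea; apply: xEs; exists i.
move=> /existsNP[a /not_implyP[[i _ Eia] xa]]; exists i => //.
by rewrite fE /= => /(_ a Eia).
Qed.

HB.instance Definition _ := isOpenTopological.Build (Spec A)
  zariski_openT zariski_openI zariski_open_bigU.

End ZariskiTopology.

Section Localization.
Variables (A : comPzRingType) (x : Spec A).

Definition denominator := {s : A | s \notin prime_of x}.

Lemma denominatorP (s : denominator) : ~ prime_of x (sval s).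
Proof. by move: (svalP s) => /negP sx xs; apply: sx; rewrite inE. Qed.

Lemma denominator1_subproof : 1 \notin prime_of x.
Proof. by apply/negP; rewrite inE; have [] := prime_ofP x. Qed.

Lemma denominatorM_subproof (s t : denominator) :
  sval s * sval t \notin prime_of x.
Proof.
apply/negP; rewrite inE => st; have [_ _ /(_ _ _ st)] := prime_ofP x.
by move=> []; apply: denominatorP.
Qed.

Definition denominator1 : denominator := exist _ 1 denominator1_subproof.
Definition denominatorM (s t : denominator) : denominator :=
  exist _ (sval s * sval t) (denominatorM_subproof s t).

Local Notation fraction := (A * denominator)%type.

Definition equivl (f g : fraction) : bool :=
  `[< exists u : denominator,
        sval u * (f.1 * sval g.2) = sval u * (g.1 * sval f.2) >].

Lemma equivl_refl : reflexive equivl.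
Proof. by move=> f; apply/asboolP; exists denominator1. Qed.

Lemma equivl_sym : symmetric equivl.
Proof.
by move=> f g; apply/asboolP/asboolP => -[u fg]; exists u; rewrite fg.
Qed.

Lemma equivl_trans : transitive equivl.
Proof.
move=> [b t] [a s] [c r] /asboolP[u /= ab] /asboolP[v /= bc]; apply/asboolP.
exists (denominatorM t (denominatorM u v)) => /=.
transitivity (sval v * sval r * (sval u * (a * sval t))); first by ring.
rewrite ab; transitivity (sval u * sval s * (sval v * (b * sval r))); first by ring.
by rewrite bc; ring.
Qed.

Canonical equivl_equiv := EquivRel equivl equivl_refl equivl_sym equivl_trans.

Definition localization := {eq_quot equivl}.
HB.instance Definition _ : EqQuotient _ equivl localization :=
  EqQuotient.on localization.
HB.instance Definition _ := Choice.on localization.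

Definition frac (a : A) (s : denominator) : localization :=
  \pi_localization (a, s).

Lemma frac_eqP a s b t :
  frac a s = frac b t <->
  exists u : denominator, sval u * (a * sval t) = sval u * (b * sval s).
Proof.
by split=> [/eqmodP/asboolP //|ab]; apply/eqmodP/asboolP.
Qed.

Lemma fracW (P : localization -> Prop) :
  (forall a s, P (frac a s)) -> forall f, P f.
Proof. by move=> Pf f; rewrite -[f]reprK; case: (repr f) => a s; exact: Pf. Qed.

Definition addl (f g : localization) : localization :=
  let: (a, s) := repr f in let: (b, t) := repr g in
  frac (a * sval t + b * sval s) (denominatorM s t).

Definition oppl (f : localization) : localization :=
  let: (a, s) := repr f in frac (- a) s.

Definition mull (f g : localization) : localization :=
  let: (a, s) := repr f in let: (b, t) := repr g in
  frac (a * b) (denominatorM s t).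

Lemma repr_frac a s :
  exists u : denominator,
    sval u * ((repr (frac a s)).1 * sval s) =
    sval u * (a * sval (repr (frac a s)).2).
Proof.
by apply/frac_eqP; rewrite /frac -surjective_pairing reprK.
Qed.

Lemma addlE a s b t :
  addl (frac a s) (frac b t) =
  frac (a * sval t + b * sval s) (denominatorM s t).
Proof.
rewrite /addl; have [u] := repr_frac a s; have [v] := repr_frac b t.
case: (repr (frac a s)) (repr (frac b t)) => [a' s'] [b' t'] /= eb ea.
apply/frac_eqP; exists (denominatorM u v) => /=.
transitivity (sval v * sval t * sval t' * (sval u * (a' * sval s)) +
              sval u * sval s * sval s' * (sval v * (b' * sval t))); first by ring.
by rewrite ea eb; ring.
Qed.

Lemma opplE a s : oppl (frac a s) = frac (- a) s.
Proof.
rewrite /oppl; have [u] := repr_frac a s.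
case: (repr (frac a s)) => [a' s'] /= ea; apply/frac_eqP; exists u.
by rewrite !mulNr !mulrN ea.
Qed.

Lemma mullE a s b t :
  mull (frac a s) (frac b t) = frac (a * b) (denominatorM s t).
Proof.
rewrite /mull; have [u] := repr_frac a s; have [v] := repr_frac b t.
case: (repr (frac a s)) (repr (frac b t)) => [a' s'] [b' t'] /= eb ea.
apply/frac_eqP; exists (denominatorM u v) => /=.
transitivity ((sval u * (a' * sval s)) * (sval v * (b' * sval t))); first by ring.
by rewrite ea eb; ring.
Qed.

Lemma eq_frac a s b t : a * sval t = b * sval s -> frac a s = frac b t.
Proof. by move=> ab; apply/frac_eqP; exists denominator1; rewrite ab. Qed.

Lemma addlA : associative addl.
Proof.
elim/fracW=> a s; elim/fracW=> b t; elim/fracW=> c r; rewrite !addlE.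
by apply: eq_frac => /=; ring.
Qed.

Lemma addlC : commutative addl.
Proof.
elim/fracW=> a s; elim/fracW=> b t; rewrite !addlE.
by apply: eq_frac => /=; ring.
Qed.

Lemma add0l : left_id (frac 0 denominator1) addl.
Proof. by elim/fracW=> a s; rewrite addlE; apply: eq_frac => /=; ring. Qed.

Lemma addNl : left_inverse (frac 0 denominator1) oppl addl.
Proof.
by elim/fracW=> a s; rewrite opplE addlE; apply: eq_frac => /=; ring.
Qed.

HB.instance Definition _ :=
  GRing.isZmodule.Build localization addlA addlC add0l addNl.

Lemma mullA : associative mull.
Proof.
elim/fracW=> a s; elim/fracW=> b t; elim/fracW=> c r; rewrite !mullE.
by apply: eq_frac => /=; ring.
Qed.

Lemma mullC : commutative mull.
Proof.
elim/fracW=> a s; elim/fracW=> b t; rewrite !mullE.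
by apply: eq_frac => /=; ring.
Qed.

Lemma mul1l : left_id (frac 1 denominator1) mull.
Proof. by elim/fracW=> a s; rewrite mullE; apply: eq_frac => /=; ring. Qed.

Lemma mullDl : left_distributive mull addl.
Proof.
elim/fracW=> a s; elim/fracW=> b t; elim/fracW=> c r.
by rewrite addlE !mullE addlE; apply: eq_frac => /=; ring.
Qed.

HB.instance Definition _ :=
  GRing.Zmodule_isComPzRing.Build localization mullA mullC mul1l mullDl.

Definition localization_maximal_ideal : set localization :=
  [set f | exists2 a, prime_of x a & exists s, f = frac a s].

Lemma localization_maximal_idealE a s :
  localization_maximal_ideal (frac a s) <-> prime_of x a.
Proof.
split=> [[b xb [t /frac_eqP[u ab]]]|xa]; last by exists a => //; exists s.
have [[_ _ xM] _ xP] := prime_ofP x.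
have : prime_of x (sval u * (a * sval t)).
  by rewrite ab [b * _]mulrC; apply: (xM); apply: (xM).
move=> /xP[/denominatorP //|/xP[//|/denominatorP //]].
Qed.

Lemma fracB_subproof a s b :
  frac a s - frac b denominator1 = frac (a - b * sval s) s.
Proof.
rewrite [LHS](_ : _ = addl (frac a s) (oppl (frac b denominator1))) //.
by rewrite opplE addlE; apply: eq_frac => /=; ring.
Qed.

End Localization.

(* An R-algebra is a commutative ring A with a ring morphism phi : R -> A;
   comAlgType R would exclude the zero algebra, whose spectrum is empty. *)
Section Varieties.
Variables (R : realType) (A : comPzRingType) (phi : {rmorphism R -> A}).

Definition subalgebra (B : set A) :=
  [/\ forall c, B (phi c), forall a b, B a -> B b -> B (a - b) &
      forall a b, B a -> B b -> B (a * b)].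

Definition finitely_generated_algebra :=
  exists s : seq A, smallest subalgebra [set` s] = setT.

Definition smooth_affine_variety :=
  finitely_generated_algebra /\
  (forall x : Spec A, regular_local_ring (localization x)).

(* The R-algebra morphism f : A -> R corresponds to the point ker f. *)
Definition rational_points : set (Spec A) :=
  [set x | exists2 f : {rmorphism A -> R},
     (forall c, f (phi c) = c) & prime_of x = [set a | f a = 0]].

(* The residue field of x is the quotient of the local ring at x by its maximal
   ideal; x is rational when R maps bijectively onto it. *)
Lemma rational_points_residue (x : Spec A) :
  rational_points x <->
  forall u : localization x, exists! c : R,
    localization_maximal_ideal (u - frac (phi c) (denominator1 x)).
Proof.
have [[x0 xD xM] x1 xP] := prime_ofP x.
have xN a : prime_of x a -> prime_of x (- a).
  by move=> xa; rewrite -mulN1r; apply: xM.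
have xphi c : prime_of x (phi c) -> c = 0.
  move=> xc; apply: contrapT => /eqP c0; apply: x1.
  by rewrite -(rmorph1 phi) -(mulVf c0) rmorphM; apply: xM.
split=> [[f fphi xf]|H].
  have {}xf a : prime_of x a <-> f a = 0 by rewrite xf.
  elim/fracW=> a s; have fs : f (sval s) != 0.
    by apply/eqP => fs; apply: (@denominatorP _ x s); apply/xf.
  have key c : localization_maximal_ideal
      (frac a s - frac (phi c) (denominator1 x)) <-> f a = c * f (sval s).
    rewrite fracB_subproof localization_maximal_idealE; apply: (iff_trans (xf _)).
    rewrite rmorphB rmorphM fphi.
    by split=> [/eqP|->]; rewrite ?subrr // subr_eq0 => /eqP.
  exists (f a / f (sval s)); split; first by apply/key; rewrite divfK.
  by move=> c /key ->; rewrite mulfK.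
have /choice[g xg] a : exists c, prime_of x (a - phi c).
  have [c [+ _]] := H (frac a (denominator1 x)).
  by rewrite fracB_subproof localization_maximal_idealE /= mulr1; exists c.
have gE a c : prime_of x (a - phi c) -> g a = c.
  move=> xc; apply/eqP; rewrite -subr_eq0; apply/eqP/xphi.
  rewrite (_ : phi _ = (a - phi c) - (a - phi (g a))).
    by apply: xD => //; apply: xN.
  by rewrite rmorphB; ring.
have gB : zmod_morphism g.
  move=> a b; apply: gE; rewrite rmorphB.
  rewrite (_ : _ - _ = (a - phi (g a)) - (b - phi (g b))); last by ring.
  by apply: xD => //; apply: xN.
have gM : monoid_morphism g.
  split=> [|a b]; first by apply: gE; rewrite rmorph1 subrr.
  apply: gE; rewrite rmorphM.
  rewrite (_ : _ - _ = b * (a - phi (g a)) + phi (g a) * (b - phi (g b))).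
    by apply: xD; apply: xM.
  by ring.
pose f : {rmorphism A -> R} := HB.pack g
  (GRing.isZmodMorphism.Build A R g gB) (GRing.isMonoidMorphism.Build A R g gM).
exists f => [c|]; first by apply: gE; rewrite subrr.
apply/seteqP; split=> a /=; first by move=> xa; apply: gE; rewrite rmorph0 subr0.
by move=> ga; have := xg a; rewrite [g a]ga rmorph0 subr0.
Qed.

Definition no_imaginary_components :=
  forall x : Spec A, connected_component setT x `&` rational_points !=set0.

End Varieties.

(* Main.v *)
Require Import Defs.
From HB Require Import structures.
From mathcomp Require Import all_boot all_order all_algebra.
From mathcomp Require Import boolp classical_sets reals topology.
From mathcomp Require Import functions normedtype sequences interval_inference.
From mathcomp Require Import ring lra.

(** Let [a] be nonzero at a point [x], and let [y] be a rational point in the connected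
    component of [x]. The regular local rings of [A] are domains, so the kernel of
    [A -> A_x] is a prime ideal that only depends on the connected component of [x];
    hence [a] is nonzero in [A_y]. Dividing [A_y] by regular parameters one at a time,
    never by one of the finitely many that divide [a], gives a curve that is regular at
    [y] and on which [a] is not identically zero. In an affine space this curve is given
    near [y] by equations [Y_j = q_j (T, Y)] with [q_j] of order two, so for every small
    real value of the parameter [T] a contraction has a fixed point, which is a rational
    point of the curve. Near [y] the function [a] is a unit times a power of [T] on the
    curve, so it does not vanish there. *)

Set Implicit Arguments.
Unset Strict Implicit.
Unset Printing Implicit Defensive.

Import GRing.Theory Num.Theory Order.TTheory.
Import numFieldNormedType.Exports.
Local Open Scope classical_set_scope.
Local Open Scope ring_scope.

(** * Ideals of Noetherian rings *)

Section IdealTheory.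
Variable A : comPzRingType.
Implicit Types (I J K L P Q : set A) (a b c x : A).

Lemma idealN I a : ideal I -> I a -> I (- a).
Proof. by move=> [_ _ IM] Ia; rewrite -mulN1r; apply: IM. Qed.

Lemma idealB I a b : ideal I -> I a -> I b -> I (a - b).
Proof. by move=> iI Ia Ib; have [_ ID _] := iI; apply: ID => //; apply: idealN. Qed.

Lemma ideal_mulr I a b : ideal I -> I a -> I (a * b).
Proof. by move=> [_ _ IM] Ia; rewrite mulrC; apply: IM. Qed.

Lemma idealBl I a b : ideal I -> I (a - b) -> I b -> I a.
Proof. by move=> [_ ID _] Iab Ib; rewrite -(subrK b a); apply: ID. Qed.

Lemma idealBr I a b : ideal I -> I (a - b) -> I a -> I b.
Proof. by move=> iI Iab Ia; rewrite -(subKr a b); apply: idealB. Qed.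

Lemma ideal_total I a : ideal I -> I 1 -> I a.
Proof. by move=> [_ _ IM] I1; rewrite -(mulr1 a); apply: IM. Qed.

Definition adjoin I x : set A := [set a | exists c, I (a - c * x)].

(* The preimage in [A] of the ideal generated by [I] in the localization at [P]. *)
Definition saturation P I : set A := [set a | exists2 s, ~ P s & I (s * a)].

Definition saturated P I := saturation P I `<=` I.

Lemma adjoin_ideal I x : ideal I -> ideal (adjoin I x).
Proof.
move=> iI; have [I0 ID IM] := iI; split=> [|a b [c Ic] [d Id]|a b [c Ic]].
- by exists 0; rewrite mul0r subr0.
- exists (c + d); rewrite (_ : _ - _ = (a - c * x) + (b - d * x)); first exact: ID.
  by ring.
- exists (a * c); rewrite (_ : _ - _ = a * (b - c * x)); first exact: IM.
  by ring.
Qed.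

Lemma sub_adjoin I x : I `<=` adjoin I x.
Proof. by move=> a Ia; exists 0; rewrite mul0r subr0. Qed.

Lemma adjoin_mem I x : ideal I -> adjoin I x x.
Proof. by move=> [I0 _ _]; exists 1; rewrite mul1r subrr. Qed.

Lemma adjoin_sub I J x : ideal J -> I `<=` J -> J x -> adjoin I x `<=` J.
Proof.
move=> iJ IJ Jx a [c Ic]; apply: (idealBl iJ (IJ _ Ic)).
by have [_ _ JM] := iJ; apply: JM.
Qed.

Lemma adjoinS I J x : I `<=` J -> adjoin I x `<=` adjoin J x.
Proof. by move=> IJ a [c Ic]; exists c; apply: IJ. Qed.

Lemma prime_notM P s t : prime_ideal P -> ~ P s -> ~ P t -> ~ P (s * t).
Proof. by move=> [_ _ PP] Ps Pt /PP[]. Qed.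

Lemma prime_not1 P : prime_ideal P -> ~ P 1.
Proof. by case. Qed.

Lemma prime_exp P x n : prime_ideal P -> P (x ^+ n) -> P x.
Proof.
move=> [_ P1 PP]; elim: n => [|n IHn]; first by rewrite expr0.
by rewrite exprS => /PP[].
Qed.

Lemma prime_subB P s c x : prime_ideal P -> P x -> ~ P s -> ~ P (s - c * x).
Proof.
move=> [iP _ _] Px Ps Psc; apply: Ps; apply: (idealBl iP Psc).
by have [_ _] := iP; apply.
Qed.

Lemma sub_saturation P I : prime_ideal P -> I `<=` saturation P I.
Proof. by move=> /prime_not1 P1 a Ia; exists 1; rewrite ?mul1r. Qed.

Lemma saturation_ideal P I : prime_ideal P -> ideal I -> ideal (saturation P I).
Proof.
move=> pP iI; have [I0 ID IM] := iI.
split=> [|a b [s Ps sa] [t Pt tb]|a b [s Ps sb]].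
- by exists 1; [exact: prime_not1|rewrite mulr0].
- exists (s * t); first exact: prime_notM.
  rewrite (_ : _ * _ = t * (s * a) + s * (t * b)); last by ring.
  by apply: ID; apply: IM.
- by exists s => //; rewrite mulrCA; apply: IM.
Qed.

Lemma saturation_saturated P I : prime_ideal P -> saturated P (saturation P I).
Proof.
move=> pP a [s Ps [t Pt tsa]]; exists (t * s); first exact: prime_notM.
by rewrite -mulrA.
Qed.

Lemma saturationS P I J : I `<=` J -> saturation P I `<=` saturation P J.
Proof. by move=> IJ a [s Ps sa]; exists s => //; apply: IJ. Qed.

Lemma colon_ideal I b : ideal I -> ideal [set a | I (a * b)].
Proof.
move=> [I0 ID IM]; split=> [|a c Ia Ic|a c Ic] /=.
- by rewrite mul0r.
- by rewrite mulrDl; apply: ID.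
- by rewrite -mulrA; apply: IM.
Qed.

Lemma ideal_generated_ideal (s : seq A) : ideal (ideal_generated s).
Proof.
split=> [I [[I0 _ _] _]//|a b Ia Ib I II|a b Ib I II].
- by have [[_ ID _] _] := II; apply: ID; [apply: Ia|apply: Ib].
- by have [[_ _ IM] _] := II; apply: IM; apply: Ib.
Qed.

Lemma ideal_generated_mem (s : seq A) a : a \in s -> ideal_generated s a.
Proof. by move=> sa I [_]; apply. Qed.

Lemma ideal_generated_sub (s : seq A) I :
  ideal I -> {in s, forall a, I a} -> ideal_generated s `<=` I.
Proof. by move=> iI sI a; apply; split. Qed.

End IdealTheory.

(** * Noetherian induction, Nakayama's lemma and Krull's principal ideal theorem *)

Section Noetherian.
Variable A : comPzRingType.
Hypothesis noethA : noetherian A.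
Implicit Types (I J K L M P Q : set A) (a b c x : A).

(** The union of a nonempty chain in [F] is finitely generated, and one member contains all its
    generators, so the union is that member. Zorn's lemma is applied with [set0] added to [F], to
    bound the empty chain. *)
Lemma noetherian_maximal (F : set (set A)) I :
  F `<=` ideal (A:=A) -> F I ->
  exists2 M, F M & forall N, F N -> M `<=` N -> N `<=` M.
Proof.
move=> Fideal FI.
have [G GF Gtot|M [MF Mmax]] := @Zorn_bigcup _ [set X | X = set0 \/ F X].
  have [GF0|/existsNP[X /not_implyP[GX X0]]] := EM (forall X, G X -> X = set0).
    by left; rewrite bigcup0.
  have FG Y a : G Y -> Y a -> F Y.
    by move=> /GF[->//|].
  right; set U := \bigcup_(_ in _) _.
  have iU : ideal U.
    split=> [|a b [Y GY Ya] [Z GZ Zb]|a b [Y GY Yb]].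
    - exists X => //; have [//|/Fideal[]//] := GF X GX.
    - have [YZ|ZY] := Gtot _ _ GY GZ.
      + exists Z => //; have [_ + _] := Fideal _ (FG _ _ GZ Zb); apply => //.
        exact: YZ.
      + exists Y => //; have [_ + _] := Fideal _ (FG _ _ GY Ya); apply => //.
        exact: ZY.
    - by exists Y => //; have [_ _] := Fideal _ (FG _ _ GY Yb); apply.
  have [s sU] := noethA iU.
  have [Y [GY FY] sY] : exists2 Y, G Y /\ F Y & {in s, forall a, Y a}.
    have {sU} : {in s, forall a, U a}.
      by move=> a /ideal_generated_mem; rewrite sU.
    elim: s => [|a s IHs] sU; first by exists X => //; split=> //; case: (GF X GX).
    have [|Y [GY FY] sY] := IHs; first by move=> b bs; apply: sU; rewrite in_cons bs orbT.
    have [Z GZ Za] := sU a (mem_head _ _).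
    have [YZ|ZY] := Gtot _ _ GY GZ.
      exists Z => [|b]; first by split=> //; apply: FG Za.
      by rewrite in_cons => /predU1P[->//|/sY/YZ].
    by exists Y => // b; rewrite in_cons => /predU1P[->|/sY//]; apply: ZY.
  rewrite (_ : U = Y) //; apply/seteqP; split; last by move=> a Ya; exists Y.
  by rewrite -sU; apply: ideal_generated_sub => //; apply: Fideal.
have FM : F M.
  have [M0|//] := MF; have [I0 _ _] := Fideal _ FI.
  have : set0 `<` I by split=> // /(_ 0 I0).
  by rewrite -M0 => /Mmax[]; right.
exists M => // N FN MN; apply: contrapT => NM.
by apply: (Mmax N); [split|right].
Qed.

(* If [J] is maximal among the saturated ideals containing [L] but not [I], then [J]
   absorbs [x * b] for every [b] in [I]. *)
Lemma nakayama P I L x :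
  prime_ideal P -> P x -> ideal L -> saturated P L ->
  (forall a, I a -> exists2 s, ~ P s & exists2 b, I b & L (s * a - x * b)) ->
  I `<=` L.
Proof.
move=> pP Px iL sL IL; apply: contrapT => nIL.
pose F J := [/\ ideal J, saturated P J, L `<=` J & ~ I `<=` J].
have [J [iJ sJ LJ nIJ] Jmax] := @noetherian_maximal F L (fun J => fun '(And4 iJ _ _ _) => iJ)
  (And4 iL sL (fun _ => id) nIL).
apply: nIJ => a /IL[s Ps [b Ib Lab]]; apply: (sJ); exists s => //.
apply: (idealBl iJ (LJ _ Lab)).
apply: contrapT => nJxb.
pose J' := saturation P (adjoin J (x * b)).
have iJ' : ideal J' by apply: saturation_ideal => //; apply: adjoin_ideal.
have JJ' : J `<=` J' by move=> c Jc; apply: sub_saturation => //; apply: sub_adjoin.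
have IJ' : I `<=` J'.
  apply: contrapT => nIJ'; apply: nJxb; apply: (Jmax J') => //.
  - split=> //; first exact: saturation_saturated.
    by move=> c /LJ/JJ'.
  - by apply: sub_saturation => //; apply: adjoin_mem.
(* Modulo [J], [t * b] equals [c * x * b], and [t - c * x] stays outside [P]; as [J] is saturated,
   it contains [b]. *)
have [t Pt [c Jc]] := IJ' _ Ib.
have [_ _ JM] := iJ; apply: nJxb; apply: JM; apply: sJ.
exists (t - c * x); first exact: prime_subB.
by rewrite (_ : _ * _ = t * b - c * (x * b)) //; ring.
Qed.

(** This makes repeated division stop. Take [b] in [W] with the saturation of [L + (b)] maximal. If
    [s * b] were [x * c] modulo [L], then by maximality [c] would lie in that saturation, hence be a
    multiple of [x * c] up to a factor outside [P], and so belong to [L]. *)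
Lemma exists_indecomposable P L (W : set A) a :
  prime_ideal P -> ideal L -> saturated P L -> W `&` L = set0 -> W a ->
  exists2 b, W b & forall s x c, ~ P s -> P x -> W c -> ~ L (s * b - x * c).
Proof.
move=> pP iL sL WL Wa.
pose F J := exists2 b, W b & J = saturation P (adjoin L b).
have Fideal : F `<=` ideal (A:=A).
  by move=> _ [b _ ->]; apply: saturation_ideal => //; apply: adjoin_ideal.
have Fa : F (saturation P (adjoin L a)) by exists a.
have [_ [b Wb ->] bmax] := noetherian_maximal Fideal Fa.
exists b => // s x c Ps Px Wc Lbc.
have iLc : ideal (saturation P (adjoin L c)).
  by apply: saturation_ideal => //; apply: adjoin_ideal.
have : saturation P (adjoin L c) c by apply: sub_saturation => //; apply: adjoin_mem.
move=> /(bmax _ (ex_intro2 _ _ c Wc erefl)) [|t Pt [d Ld]].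
  apply: subset_trans (@saturation_saturated _ P (adjoin L c) pP).
  apply: saturationS; apply: adjoin_sub => // [e Le|].
    by apply: sub_saturation => //; apply: sub_adjoin.
  by exists s => //; exists x.
have : set0 c; last by [].
rewrite -WL; split=> //; apply: sL; exists (s * t - d * x).
  by apply: prime_subB => //; apply: prime_notM.
have [_ LD LM] := iL.
rewrite (_ : _ * _ = s * (t * c - d * b) + d * (s * b - x * c)); last by ring.
by apply: LD => //; apply: LM.
Qed.

Lemma saturation_uniform P I J : prime_ideal P -> ideal J -> ideal I ->
  I `<=` saturation P J -> exists2 s, ~ P s & forall a, I a -> J (s * a).
Proof.
move=> pP iJ iI; have [l <-] := noethA iI => lJ; have [_ _ JM] := iJ.
have {lJ} : {in l, forall a, saturation P J a}.
  by move=> a /ideal_generated_mem/lJ.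
suff H : {in l, forall a, saturation P J a} ->
    exists2 s, ~ P s & {in l, forall a, J (a * s)}.
  move=> /H[s Ps sl]; exists s => // a la; rewrite mulrC.
  by apply: (@ideal_generated_sub _ l [set a | J (a * s)]) la => //; apply: colon_ideal.
elim: l => [|a l IHl] lJ; first by exists 1 => //; apply: prime_not1.
have [|s Ps sl] := IHl; first by move=> b bl; apply: lJ; rewrite in_cons bl orbT.
have [t Pt ta] := lJ a (mem_head _ _).
exists (s * t); first exact: prime_notM.
move=> b; rewrite in_cons => /predU1P[->|/sl sb].
  by rewrite mulrC -mulrA; apply: JM.
by rewrite mulrA; apply: ideal_mulr.
Qed.

(** This is an associated prime of [A / I]: when the annihilator of [b] is maximal and [c * b] is
    not in [I], the annihilator of [c * b] is the same. *)
Lemma exists_prime_colon I :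
  ideal I -> ~ I 1 -> exists2 b, ~ I b & prime_ideal [set a | I (a * b)].
Proof.
move=> iI I1; pose F J := exists2 b, ~ I b & J = [set a | I (a * b)].
have [_ _ IM] := iI.
have [||_ [b Ib ->] bmax] := @noetherian_maximal F [set a | I (a * 1)].
- by move=> _ [b _ ->]; apply: colon_ideal.
- by exists 1.
exists b => //; split=> [||a c /= Iac]; first exact: colon_ideal.
  by rewrite /= mul1r.
have [|Icb] := EM (I (c * b)); [by right|left].
suff : [set d | I (d * (c * b))] a.
  move=> /bmax; apply; first by exists (c * b).
  by move=> d /= Idb; rewrite mulrCA; apply: IM.
by rewrite /= mulrA.
Qed.

(* The localization of [A / M] at [P] is Artinian. *)
Lemma decreasing_stationary P M (J : nat -> set A) :
  prime_ideal P -> ideal M ->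
  (forall P', prime_ideal P' -> M `<=` P' -> P' `<=` P -> P `<=` P') ->
  (forall n, [/\ ideal (J n), saturated P (J n) & M `<=` J n]) ->
  (forall n, J n.+1 `<=` J n) ->
  exists n, J n `<=` J n.+1.
Proof.
move=> pP iM minP JP Jdecr.
have Jmono n k : J (n + k)%N `<=` J n.
  by elim: k => [|k IHk]; rewrite ?addn0// addnS => a /Jdecr/IHk.
(* The traces of the chain on a member of [F] are constant from [N] on. The intersection of the
   chain is a member, and a maximal member is shown to be the whole ring. *)
pose F L := [/\ ideal L, saturated P L, M `<=` L &
  exists N, forall k, J N `&` L `<=` J (N + k)%N].
have Fideal : F `<=` ideal (A:=A) by move=> ? [].
have [||L [iL sL ML [N JL]] Lmax] := @noetherian_maximal F (\bigcap_n J n) => //.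
  split.
  - split=> [n _|a b Ja Jb n _|a b Jb n _]; have [[J0 JD JM] _ _] := JP n => //.
      by apply: JD; [apply: Ja|apply: Jb].
    by apply: JM; apply: Jb.
  - move=> a [s Ps Jsa] n _; have [_ sJ _] := JP n; apply: sJ.
    by exists s => //; apply: Jsa.
  - by move=> a Ma n _; have [_ _ MJ] := JP n; apply: MJ.
  - by exists 0%N => k a [_]; apply.
have [L1|/(exists_prime_colon iL)[b Lb pLb]] := EM (L 1).
  by exists N => a Ja; rewrite -addn1; apply: JL; split=> //; apply: ideal_total.
have [_ LD LM] := iL.
(* The prime [(L : b)] contains [M], and lies in [P] because [L] is saturated and omits [b];
   minimality makes it contain [P]. *)
have PLb : P `<=` [set a | L (a * b)].
  apply: minP => //; first by move=> a Ma; apply: ideal_mulr => //; apply: ML.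
  move=> a /= Lab; apply: contrapT => Pa; apply: Lb; apply: sL.
  by exists a.
pose L' := saturation P (adjoin L b).
have LL' : L `<=` L' by move=> c Lc; apply: sub_saturation => //; apply: sub_adjoin.
exfalso; apply: Lb; apply: (Lmax L') => //; last first.
  by apply: sub_saturation => //; apply: adjoin_mem.
split.
- by apply: saturation_ideal => //; apply: adjoin_ideal.
- exact: saturation_saturated.
- by move=> a /ML/LL'.
(* Locally at [P], the quotient [L' / L] is a line over the residue field, so each [J (N + k)] has
   image zero or everything in it. In the second case a multiple of some [v] in [J (N + k)] corrects
   [u], up to a factor outside [P], to an element of [L]. *)
have [[k JL'L]|nJL'] := EM (exists k, J (N + k)%N `&` L' `<=` L).
  exists (N + k)%N => i a [Ja L'a]; rewrite -addnA; apply: JL; split.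
    exact: Jmono Ja.
  exact: JL'L.
exists N => k u [Ju [s Ps [c Lsu]]].
have /existsNP[v /not_implyP[[Jv [t Pt [d Ltv]]] Lv]] := (forallNP _).2 nJL' k.
have Pd : ~ P d.
  move=> /PLb /= Ldb; apply: Lv; apply: sL; exists t => //.
  exact: (idealBl iL Ltv).
have [iJ sJ _] := JP (N + k)%N; have [_ JD JM] := iJ.
have [[_ JND JNM] _ _] := JP N.
apply: sJ; exists (d * s); first exact: prime_notM.
rewrite (_ : _ * u = (d * (s * u - c * b) - c * (t * v - d * b)) + (c * t) * v); last by ring.
apply: JD; last exact: JM.
apply: JL; split; last by apply: idealB => //; apply: LM.
rewrite (_ : _ - _ = d * s * u + (- c * t) * v); last by ring.
by apply: JND; apply: JNM => //; apply: Jmono Jv.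
Qed.

(* Krull's principal ideal theorem. *)
Lemma prime_between Q P' P x :
  prime_ideal Q -> prime_ideal P' -> prime_ideal P ->
  Q `<` P' -> P' `<` P -> P x -> ~ Q x ->
  exists P'', [/\ prime_ideal P'', Q `<=` P'', P'' x & P'' `<` P].
Proof.
move=> pQ pP' pP [QP' nP'Q] [P'P nPP'] Px Qx; apply: contrapT => H.
have minP P'' : prime_ideal P'' -> adjoin Q x `<=` P'' -> P'' `<=` P -> P `<=` P''.
  move=> pP'' QxP'' P''P; apply: contrapT => nPP''; apply: H; exists P''; split=> //.
    by move=> a Qa; apply: QxP''; apply: sub_adjoin.
  by apply: QxP''; apply: adjoin_mem; case: pQ.
have [iQ _ QP] := pQ; have [iP _ _] := pP; have [iP' _ _] := pP'.
have P'x : ~ P' x.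
  by move=> P'x; apply: nPP'; apply: minP => //; apply: adjoin_sub.
have /existsNP[b /not_implyP[P'b Qb]] := nP'Q.
(* These ideals play the role of the symbolic powers of [P'] modulo [Q]. *)
pose I n := saturation P' (adjoin Q (b ^+ n)).
have iI n : ideal (I n) by apply: saturation_ideal => //; apply: adjoin_ideal.
have sI n : saturated P' (I n) by apply: saturation_saturated.
have QI n : Q `<=` I n by move=> a Qa; apply: sub_saturation => //; apply: sub_adjoin.
have Idecr n : I n.+1 `<=` I n.
  apply: saturationS; apply: adjoin_sub; [exact: adjoin_ideal|exact: sub_adjoin|].
  by exists b; rewrite exprS subrr; case: iQ.
pose J n := saturation P (adjoin (I n) x).
have [||n] := @decreasing_stationary P (adjoin Q x) J pP (adjoin_ideal x iQ) minP.
- move=> n; split.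
  + by apply: saturation_ideal => //; apply: adjoin_ideal.
  + exact: saturation_saturated.
  + by move=> a Qxa; apply: sub_saturation => //; apply: adjoinS Qxa.
- by move=> n; apply: saturationS; apply: adjoinS; apply: Idecr.
(* Stationarity puts [I n] inside [I n.+1 + (x)] locally at [P]. The cofactor of [x] is again in
   [I n], because [x] is outside [P'], so Nakayama's lemma applies. *)
move=> JJ; have II : I n `<=` I n.+1.
  apply: (nakayama pP Px (iI _)).
    by move=> a [s Ps sa]; apply: sI; exists s => // /P'P.
  move=> a Ia.
  have /JJ[s Ps [c Ic]] : J n a by apply: sub_saturation => //; apply: sub_adjoin.
  exists s => //; exists c; last by rewrite mulrC [x * c]mulrC -[a * s]mulrC.
  have [_ _ IM] := iI n.
  apply: sI; exists x => //; rewrite mulrC; apply: (idealBr (iI n) (Idecr _ _ Ic)).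
  exact: IM.
(* Now [b ^+ n * (s - c * b)] lies in [Q], although neither [b] nor [s - c * b] does. *)
have /II[s P's [c]] : I n (b ^+ n) by apply: sub_saturation => //; apply: adjoin_mem.
rewrite (_ : _ - _ = (b ^+ n) * (s - c * b)); last by rewrite exprS; ring.
move=> /QP[/(prime_exp pQ)//|/QP'].
exact: prime_subB.
Qed.

End Noetherian.

(** * Chains of primes and regular local rings *)

Section Chains.
Variable A : comPzRingType.
Implicit Types (L P Q : set A) (x : A) (n : nat).

(** The index counts strict inclusions. As [L] is any set, chains in a quotient [A / L] are handled
    without forming the quotient. *)
Inductive chain_above L : nat -> set A -> Prop :=
| chain_above0 P : prime_ideal P -> L `<=` P -> chain_above L 0 P
| chain_aboveS n Q P :
    chain_above L n Q -> prime_ideal P -> Q `<` P -> chain_above L n.+1 P.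

Lemma chain_above_prime L n P : chain_above L n P -> prime_ideal P.
Proof. by case. Qed.

Lemma chain_above_sub L n P : chain_above L n P -> L `<=` P.
Proof. by elim=> // {}n Q {}P _ LQ _ [QP _]; apply: subset_trans QP. Qed.

Lemma chain_aboveW L K n P : L `<=` K -> chain_above K n P -> chain_above L n P.
Proof.
move=> LK; elim=> [{}P pP KP|{}n Q {}P _ LQ pP QP].
  by apply: chain_above0 => //; apply: subset_trans KP.
exact: chain_aboveS QP.
Qed.

Lemma chain_above_bottom L n P :
  chain_above L n P -> exists P0, [/\ prime_ideal P0, L `<=` P0 & chain_above P0 n P].
Proof.
elim=> [{}P pP LP|{}n Q {}P _ [P0 [pP0 LP0 cQ]] pP QP].
  by exists P; split=> //; apply: chain_above0.
by exists P0; split=> //; apply: chain_aboveS QP.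
Qed.

Lemma chain_above_cons L Q n P :
  prime_ideal Q -> Q `<` L -> chain_above L n P -> chain_above Q n.+1 P.
Proof.
move=> pQ QL; elim=> [{}P pP LP|{}n P' {}P _ QP' pP P'P]; last first.
  exact: chain_aboveS P'P.
apply: (@chain_aboveS _ _ Q) => //; first exact: chain_above0.
by case: QL => QL nLQ; split=> [a /QL/LP//|PQ]; apply: nLQ => a /LP/PQ.
Qed.

Lemma chain_above_widen L n P Q :
  chain_above L n P -> prime_ideal Q -> P `<=` Q -> chain_above L n Q.
Proof.
case=> [{}P pP LP|{}n P' {}P cP' pP [P'P nPP']] pQ PQ.
  by apply: chain_above0 => //; apply: subset_trans PQ.
apply: (chain_aboveS cP') => //; split; first exact: subset_trans PQ.
by move=> /(subset_trans PQ).
Qed.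

(** The principal ideal theorem pushes [x] down the chain: if the prime [Q] below [P] omits [x], it
    is exchanged for a prime that contains [x] and lies between the next lower prime and [P]. Only
    the bottom prime is lost. *)
Lemma chain_above_adjoin L n P x : noetherian A ->
  chain_above L n.+1 P -> P x -> chain_above (adjoin L x) n P.
Proof.
move=> noethA; elim: n P => [|n IHn] P cP Px.
  have [iP _ _] := chain_above_prime cP.
  apply: chain_above0; first exact: chain_above_prime cP.
  by apply: adjoin_sub => //; apply: chain_above_sub cP.
case En : _ _ / cP => [//|m Q {}P cQ pP QP] in Px *.
case: En cQ => {m}<- cQ.
have [Qx|nQx] := EM (Q x); first by apply: chain_aboveS QP => //; apply: IHn.
case Em : _ _ / cQ => [//|m Q' {}Q cQ' pQ Q'Q] in QP nQx *.
case: Em cQ' => {m}<- cQ'.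
have pQ' := chain_above_prime cQ'.
have nQ'x : ~ Q' x by case: Q'Q => /(_ x) + _ => /[apply].
have [Q'' [pQ'' Q'Q'' Q''x Q''P]] := prime_between noethA pQ' pQ pP Q'Q QP Px nQ'x.
apply: chain_aboveS Q''P => //; apply: IHn => //.
by apply: (chain_aboveS cQ') => //; split=> // /(_ _ Q''x).
Qed.

End Chains.

Section LocalRing.
Variables (A : comPzRingType) (m : set A).
Hypothesis noethA : noetherian A.
Hypothesis prime_m : prime_ideal m.
Hypothesis local_m : forall s, ~ m s -> exists t, t * s = 1.
Implicit Types (I K L P Q : set A) (a b c x : A) (xs : seq A).

Fixpoint adjoin_seq L xs : set A :=
  if xs is x :: xs' then adjoin_seq (adjoin L x) xs' else L.

Lemma adjoin_seq_ideal L xs : ideal L -> ideal (adjoin_seq L xs).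
Proof. by elim: xs L => //= x xs IHxs L iL; apply: IHxs; apply: adjoin_ideal. Qed.

Lemma sub_adjoin_seq L xs : L `<=` adjoin_seq L xs.
Proof.
by elim: xs L => [|x xs IHxs] L a La //=; apply: IHxs; apply: sub_adjoin.
Qed.

Lemma adjoin_seq_mem L xs x : ideal L -> x \in xs -> adjoin_seq L xs x.
Proof.
elim: xs L => //= y xs IHxs L iL; rewrite in_cons => /predU1P[->|].
  by apply: sub_adjoin_seq; apply: adjoin_mem.
by apply: IHxs; apply: adjoin_ideal.
Qed.

Lemma adjoin_seq_sub L K xs :
  ideal K -> L `<=` K -> {in xs, forall x, K x} -> adjoin_seq L xs `<=` K.
Proof.
move=> iK; elim: xs L => [|x xs IHxs] L LK xsK //=.
apply: IHxs => [|y yxs]; last by apply: xsK; rewrite in_cons yxs orbT.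
by apply: adjoin_sub => //; apply: xsK; rewrite mem_head.
Qed.

Lemma adjoin_seqS L K xs : L `<=` K -> adjoin_seq L xs `<=` adjoin_seq K xs.
Proof. by elim: xs L K => [|x xs IHxs] L K LK //=; apply: IHxs; apply: adjoinS. Qed.

Lemma local_saturated I : ideal I -> saturated m I.
Proof.
move=> [_ _ IM] a [s /local_m[t ts] Isa].
by rewrite -[a]mul1r -ts -mulrA; apply: IM.
Qed.

Lemma adjoin_seq_between L K xs : ideal L -> L `<=` K -> K `<=` m ->
  adjoin_seq L xs = m -> adjoin_seq K xs = m.
Proof.
move=> iL LK Km Lxs; apply/seteqP; split; last by rewrite -Lxs; apply: adjoin_seqS.
apply: adjoin_seq_sub => //; first by case: prime_m.
by move=> x xxs; rewrite -Lxs; apply: adjoin_seq_mem.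
Qed.

(* Krull's height theorem, for a maximal ideal. *)
Lemma chain_above_le_size L xs n :
  ideal L -> adjoin_seq L xs = m -> chain_above L n m -> (n <= size xs)%N.
Proof.
elim: xs L n => [|x xs IHxs] L [|n] //= iL Lxs cL.
  case En : _ _ / cL => [//|k Q P cQ _ [_ nmQ]] in Lxs *.
  by case: nmQ; rewrite -Lxs; apply: chain_above_sub cQ.
apply: (IHxs (adjoin L x)) => //; first exact: adjoin_ideal.
apply: chain_above_adjoin => //; rewrite -Lxs.
by apply: (@adjoin_seq_mem L (x :: xs)); rewrite ?mem_head.
Qed.

(* A regular local ring is a domain, for the ring [A / L]. *)
Lemma regular_prime L xs :
  ideal L -> adjoin_seq L xs = m -> chain_above L (size xs) m -> prime_ideal L.
Proof.
elim: xs L => [|x xs IHxs] L iL Lxs cL; first by rewrite -[L]/(adjoin_seq L [::]) Lxs.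
have [P0 [pP0 LP0 cP0]] := chain_above_bottom cL.
have [iP0 _ PP0] := pP0; have [im _ _] := prime_m.
have P0m := chain_above_sub cP0.
have mx : m x by rewrite -Lxs; apply: adjoin_seq_mem; rewrite ?mem_head.
have cP0x := chain_above_adjoin noethA cP0 mx.
have iLx := adjoin_ideal x iL; have iP0x := adjoin_ideal x iP0.
have LxP0x : adjoin L x `<=` adjoin P0 x by apply: adjoinS.
have P0xxs : adjoin_seq (adjoin P0 x) xs = m.
  by apply: (adjoin_seq_between iLx) => //; apply: adjoin_sub.
have pLx : prime_ideal (adjoin L x).
  by apply: IHxs => //; apply: chain_aboveW cP0x.
(* Otherwise the prime [L + (x)] could be put below a chain of length [size xs] above [P0 + (x)],
   against the height bound over [L + (x)]. *)
have P0xLx : adjoin P0 x `<=` adjoin L x.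
  apply: contrapT => nLx; have LxltP0x : adjoin L x `<` adjoin P0 x by split.
  have := chain_above_le_size iLx Lxs (chain_above_cons pLx LxltP0x cP0x).
  by rewrite ltnn.
(* Otherwise [xs] alone would generate [m] over [P0], too few elements for the chain [cP0]. *)
have nP0x : ~ P0 x.
  move=> P0_x; have P0xs : adjoin_seq P0 xs = m.
    apply/seteqP; split; last by rewrite -P0xxs; apply: adjoin_seqS; apply: adjoin_sub.
    by rewrite -P0xxs; apply: adjoin_seqS; apply: sub_adjoin.
  by have := chain_above_le_size iP0 P0xs cP0; rewrite ltnn.
(* As the prime [P0] omits [x], each of its elements is, modulo [L], [x] times an element of [P0];
   Nakayama's lemma concludes. *)
rewrite (_ : L = P0) //; apply/seteqP; split=> //.
apply: (nakayama noethA prime_m mx iL (local_saturated iL)) => a P0a.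
have [c Lac] := P0xLx _ (sub_adjoin x P0a).
exists 1; first exact: prime_not1.
exists c; last by rewrite mul1r [x * c]mulrC.
have /PP0[//|//] : P0 (c * x) by apply: (idealBr iP0 (LP0 _ Lac)).
Qed.

(* The line cut out by [K] is found by quotienting by a parameter, repeatedly. The
   parameters [x1 + x2 ^+ j.+1] generate distinct primes modulo [L], and [a] is
   divisible by finitely many of them only. *)
Lemma exists_transversal_prime L xs a :
  ideal L -> adjoin_seq L xs = m -> chain_above L (size xs) m -> xs != [::] -> ~ L a ->
  exists K t, [/\ prime_ideal K, ~ K a, ~ K t & adjoin K t = m].
Proof.
elim: {xs}(size xs) {-2}xs (erefl (size xs)) L => [[]//|n IHn] [//|x1 xs] [sxs].
case: xs sxs => [|x2 xs] sxs L iL Lxs cL _ La.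
  exists L, x1; split=> //; first exact: regular_prime cL.
  move=> Lx1; have /chain_above_le_size : adjoin_seq L [::] = m.
    rewrite -Lxs /=; apply/seteqP; split; first exact: sub_adjoin.
    exact: adjoin_sub.
  by move=> /(_ _ iL cL).
have [im m1 _] := prime_m; have [m0 mD mM] := im.
have [mx1 mx2] : m x1 /\ m x2.
  by rewrite -Lxs; split; apply: adjoin_seq_mem; rewrite ?inE ?eqxx ?orbT.
have mxs : {in xs, forall x, m x}.
  by move=> x xxs; rewrite -Lxs; apply: adjoin_seq_mem; rewrite ?inE ?xxs ?orbT.
have Lm : L `<=` m by rewrite -Lxs; apply: sub_adjoin_seq.
pose p j := x1 + x2 ^+ j.+1.
have mp j : m (p j) by apply: mD => //; rewrite exprSr; apply: mM.
pose Lp j := adjoin L (p j).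
have iLp j : ideal (Lp j) by apply: adjoin_ideal.
have Lpm j : Lp j `<=` m by apply: adjoin_sub.
have Lpxs j : adjoin_seq (Lp j) (x2 :: xs) = m.
  apply/seteqP; split.
    by apply: adjoin_seq_sub => // x /predU1P[->//|/mxs].
  rewrite -Lxs; apply: adjoin_seq_sub.
  - exact: adjoin_seq_ideal.
  - by move=> b Lb; apply: sub_adjoin_seq; apply: sub_adjoin.
  - have Kx2 : adjoin_seq (Lp j) (x2 :: xs) x2 by apply: adjoin_seq_mem; rewrite ?mem_head.
    have iK : ideal (adjoin_seq (Lp j) (x2 :: xs)) by apply: adjoin_seq_ideal.
    move=> x; rewrite !inE => /predU1P[->|xxs]; last first.
      by apply: adjoin_seq_mem; rewrite ?inE.
    rewrite (_ : x1 = p j - x2 ^+ j * x2); last by rewrite /p exprSr addrK.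
    apply: idealB => //; last by have [_ _] := iK; apply.
    by apply: sub_adjoin_seq; apply: adjoin_mem.
have cLp j : chain_above (Lp j) (size xs).+1 m by apply: chain_above_adjoin.
have pLp j : prime_ideal (Lp j) by apply: regular_prime (Lpxs j) (cLp j).
have Lpx2 j : ~ Lp j x2.
  move=> Lx2; have /chain_above_le_size : adjoin_seq (Lp j) xs = m.
    rewrite -(Lpxs j) /=; apply/seteqP; split; apply: adjoin_seqS.
      exact: sub_adjoin.
    exact: adjoin_sub.
  by move=> /(_ _ (iLp j) (cLp j)); rewrite ltnn.
(* The difference [p i - p j] is a power of [x2] times an element outside [m], and the prime [Lp j]
   contains neither. *)
have Lpp i j : (i < j)%N -> ~ Lp j (p i).
  move=> ij Lpi.
  have : Lp j (p i - p j) by apply: idealB => //; apply: adjoin_mem.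
  rewrite (_ : _ - _ = x2 ^+ i.+1 * (1 - x2 ^+ (j - i))); last first.
    by rewrite mulrBr -exprD addSn subnKC ?(ltnW ij)// /p; ring.
  have [_ _ PLp] := pLp j; move=> /PLp[/(prime_exp (pLp j))/Lpx2//|/Lpm].
  by rewrite -(subnSK ij) exprSr; apply: prime_subB.
have [/existsNP[j La']|Lpa] := EM (~ forall j, Lp j a).
  by apply: (IHn (x2 :: xs)) La' => //; rewrite /= (Lpxs, cLp).
(* [W] collects the quotients of [a], modulo [L], by the first products of the [p i]. If every
   [Lp j] contains [a], an indecomposable quotient [b] is still divisible by [p k], because [Lp k]
   omits all [p i] with [i < k]. *)
pose W := [set b | ~ L b /\ exists k, L (a - (\prod_(i < k) p i) * b)].
have [||b [Lb [k Lk]] bmin] := exists_indecomposable noethA prime_m iL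
    (local_saturated iL) (W := W) (a := a).
- by apply/seteqP; split=> // b [[Lb _] /Lb].
- by split=> //; exists 0%N; rewrite big_ord0 mul1r subrr; case: iL.
exfalso.
have Lpkb : Lp k b.
  have [_ _ PLp] := pLp k.
  have : Lp k (\prod_(i < k) p i * b).
    apply: (idealBr (iLp k)); first by apply: sub_adjoin; apply: Lk.
    by apply: contrapT => Lka; apply: Lpa => /(_ k).
  move=> /PLp[|//]; elim/big_ind: _ => [/(prime_not1 (pLp k))//|u v Hu Hv /PLp[]//|].
  by move=> i _ /Lpp; case.
have [c Lc] := Lpkb.
have [_ LD LM] := iL.
have Lac : L (a - \prod_(i < k.+1) p i * c).
  rewrite big_ord_recr /= (_ : _ - _ = (a - \prod_(i < k) p i * b)
    + \prod_(i < k) p i * (b - c * p k)); last by ring.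
  by apply: LD => //; apply: LM.
apply: (bmin 1 (p k) c) => //; last by rewrite mul1r mulrC.
split; last by exists k.+1.
by move=> Lc'; apply: La; apply: (idealBl iL Lac); apply: LM.
Qed.

End LocalRing.

(** * Free algebras *)

Section HilbertBasis.
Variable B : comNzRingType.

(** The bound on the size, in place of an equality, admits zero beside the leading coefficients of
    degree [n] and so gives an ideal. *)
Definition coef_ideal (I : set {poly B}) n : set B :=
  [set b | exists2 p, I p & (size p <= n.+1)%N /\ p`_n = b].

Lemma coef_ideal_ideal I n : ideal I -> ideal (coef_ideal I n).
Proof.
move=> [I0 ID IM]; split=> [|_ _ [p Ip [sp <-]] [q Iq [sq <-]]|b _ [p Ip [sp <-]]].
- by exists 0 => //; rewrite size_poly0 coef0.
- exists (p + q); first exact: ID.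
  by rewrite coefD (leq_trans (size_polyD _ _))// geq_max sp.
- exists (b%:P * p); first exact: IM.
  by rewrite coefCM mul_polyC (leq_trans (size_scale_leq _ _)).
Qed.

Lemma coef_idealS I J n : I `<=` J -> coef_ideal I n `<=` coef_ideal J n.
Proof. by move=> IJ b [p Ip pb]; exists p => //; apply: IJ. Qed.

Lemma coef_ideal_shift I n k : ideal I -> coef_ideal I n `<=` coef_ideal I (n + k)%N.
Proof.
move=> [_ _ IM] b [p Ip [sp <-]]; exists ('X^k * p); first exact: IM.
rewrite coefXnM ltnNge leq_addl /= addnK; split=> //.
by rewrite mulrC (leq_trans (size_polyMleq _ _))// size_polyXn addnS /= -addSn leq_add2r.
Qed.

Lemma coef_ideal_total I J : ideal I -> ideal J -> J `<=` I ->
  (forall n, coef_ideal I n `<=` coef_ideal J n) -> I `<=` J.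
Proof.
move=> iI iJ JI IJ p; elim: {p}(size p) {-2}p (leqnn (size p)) => [|n IHn] p sp Ip.
  by move: sp; rewrite leqn0 size_poly_eq0 => /eqP->; case: iJ.
have [|q Jq [sq qp]] := IJ n p`_n; first by exists p.
apply: (idealBl iJ _ Jq); apply: IHn; last by apply: idealB => //; apply: JI.
apply/leq_sizeP => i; rewrite leq_eqVlt coefB => /predU1P[<-|ni].
  by rewrite qp subrr.
by rewrite !nth_default ?subrr ?(leq_trans sp, leq_trans sq).
Qed.

(** Hilbert's basis theorem: the ideals of leading coefficients grow with the degree, and the one in
    degree [N] is maximal among them. Lifts of generators in degrees up to [N] generate [I]. *)
Lemma noetherian_poly : noetherian B -> noetherian {poly B}.
Proof.
move=> noethB I iI.
have step n : exists2 s : seq {poly B}, {in s, forall p, I p} &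
    coef_ideal I n `<=` coef_ideal (ideal_generated s) n.
  have [t tI] := noethB _ (coef_ideal_ideal n iI).
  have {}tI : {in t, forall b, coef_ideal I n b} /\ coef_ideal I n `<=` ideal_generated t.
    by rewrite tI; split=> // b /ideal_generated_mem; rewrite tI.
  case: tI => tI It.
  suff [s sI st] : exists2 s : seq {poly B}, {in s, forall p, I p} &
      {in t, forall b, coef_ideal (ideal_generated s) n b}.
    exists s => //; apply: (subset_trans It); apply: ideal_generated_sub => //.
    by apply: coef_ideal_ideal; apply: ideal_generated_ideal.
  elim: t tI {It} => [|b t IHt] tI; first by exists [::].
  have [|s sI st] := IHt; first by move=> c ct; apply: tI; rewrite in_cons ct orbT.
  have [p Ip pb] := tI b (mem_head _ _).
  exists (p :: s) => [q|c]; rewrite in_cons => /predU1P[->//|]; first exact: sI.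
    by exists p => //; apply: ideal_generated_mem; rewrite mem_head.
  move=> /st; apply: coef_idealS; apply: ideal_generated_sub.
    exact: ideal_generated_ideal.
  by move=> q qs; apply: ideal_generated_mem; rewrite in_cons qs orbT.
have steps N : exists2 s : seq {poly B}, {in s, forall p, I p} &
    forall n, (n < N)%N -> coef_ideal I n `<=` coef_ideal (ideal_generated s) n.
  elim: N => [|N [s sI sN]]; first by exists [::].
  have [t tI tN] := step N; exists (s ++ t) => [p|n].
    by rewrite mem_cat => /orP[/sI|/tI].
  rewrite ltnS leq_eqVlt => /predU1P[->|nN] b.
    move=> /tN; apply: coef_idealS; apply: ideal_generated_sub.
      exact: ideal_generated_ideal.
    by move=> q qs; apply: ideal_generated_mem; rewrite mem_cat qs orbT.
  move=> /(sN _ nN); apply: coef_idealS; apply: ideal_generated_sub.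
    exact: ideal_generated_ideal.
  by move=> q qs; apply: ideal_generated_mem; rewrite mem_cat qs.
have [||_ [N _ <-] Nmax] := noetherian_maximal noethB (F := range (coef_ideal I))
    (I := coef_ideal I 0).
- by move=> _ [n _ <-]; apply: coef_ideal_ideal.
- by exists 0%N.
have [s sI sN] := steps N.+1; exists s.
have sI' : ideal_generated s `<=` I by apply: ideal_generated_sub.
apply/seteqP; split=> //; apply: coef_ideal_total => //.
  exact: ideal_generated_ideal.
move=> n; have [|Nn] := ltnP n N.+1; first exact: sN.
rewrite -(subnKC (ltnW Nn)); set k := (n - N)%N.
apply: subset_trans (coef_ideal_shift (n := N) k (ideal_generated_ideal s)).
apply: subset_trans (sN N _) => //; apply: Nmax; first by exists (N + k)%N.
exact: coef_ideal_shift.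
Qed.

End HilbertBasis.

Lemma noetherian_field (K : fieldType) : noetherian K.
Proof.
move=> I iI; have [[x Ix /eqP x0]|I0] := EM (exists2 x, I x & x <> 0).
  exists [:: 1]; apply/seteqP; split=> a _.
    apply: ideal_total => //; rewrite -(mulVf x0).
    by have [_ _] := iI; apply.
  apply: (ideal_total a (ideal_generated_ideal [:: 1])).
  by apply: ideal_generated_mem; rewrite mem_head.
exists [::]; apply/seteqP; split; first exact: ideal_generated_sub.
move=> a Ia; have [I00 _ _] := ideal_generated_ideal ([::] : seq K).
by have [->//|a0] := EM (a = 0); case: I0; exists a.
Qed.

Lemma noetherian_surj (B C : comPzRingType) (f : {rmorphism B -> C}) :
  (forall c, exists b, f b = c) -> noetherian B -> noetherian C.
Proof.
move=> fsurj noethB I iI; have [I0 ID IM] := iI.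
have iJ : ideal (f @^-1` I).
  split=> [|a b Ja Jb|a b Jb] /=; rewrite ?(rmorph0, rmorphD, rmorphM)//.
    exact: ID.
  exact: IM.
have [s sJ] := noethB _ iJ; exists (map f s); apply/seteqP; split.
  apply: ideal_generated_sub => // _ /mapP[b bs ->].
  by have : (f @^-1` I) b by rewrite -sJ; apply: ideal_generated_mem.
move=> c Ic; have [b fb] := fsurj c; rewrite -fb.
have [K0 KD KM] := ideal_generated_ideal (map f s).
have : ideal_generated s b by rewrite sJ /= fb.
move: b {fb}; apply: (@ideal_generated_sub _ s (f @^-1` ideal_generated (map f s))).
  split=> [|a b Ja Jb|a b Jb] /=; rewrite ?(rmorph0, rmorphD, rmorphM)//.
    exact: KD.
  exact: KM.
by move=> b bs /=; apply: ideal_generated_mem; apply: map_f.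
Qed.

(** This is the polynomial ring in [n] variables, built one variable at a time; only these three
    properties of it are used later. *)
Lemma exists_free_algebra (R : realType) (n : nat) :
  exists (F : comNzRingType) (iota : {rmorphism R -> F}) (X : nat -> F),
  [/\ noetherian F,
      forall S, subalgebra iota S -> (forall i, (i < n)%N -> S (X i)) -> S = setT &
      forall (B : comNzRingType) (psi : {rmorphism R -> B}) (b : nat -> B),
      exists h : {rmorphism F -> B},
        (forall c, h (iota c) = psi c) /\ (forall i, (i < n)%N -> h (X i) = b i)].
Proof.
elim: n => [|n [F [iota [X [noethF genF univF]]]]].
  exists R, idfun, (fun=> 0); split=> [|S [SR _ _] _|B psi b].
  - exact: noetherian_field.
  - by apply/seteqP; split=> // c _; apply: SR.
  - by exists psi.
exists {poly F}, (polyC \o iota), (fun i => if i is j.+1 then (X j)%:P else 'X).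
split=> [|S [Siota SB SM] SX|B psi b].
- exact: noetherian_poly.
- have SC c : S c%:P.
    suff : [set c | S c%:P] = setT by move=> /seteqP[_ /(_ c)]; apply.
    apply: genF => [|i ni]; last exact: (SX i.+1).
    split=> [c'|a a' Sa Sa'|a a' Sa Sa'] /=; first exact: Siota.
      by rewrite polyCB; apply: SB.
    by rewrite polyCM; apply: SM.
  apply/seteqP; split=> // p _; elim/poly_ind: p => [|p c Sp]; first exact: SC.
  rewrite -[c]opprK polyCN; apply: SB => //; apply: SM => //.
  exact: (SX 0%N).
- have [h [hiota hX]] := univF B psi (fun i => b i.+1).
  have cb : commr_rmorph h (b 0%N) by move=> x; apply: mulrC.
  exists (horner_morph cb); split=> [c|[|i] ni].
  + by rewrite /= horner_morphC.
  + by rewrite /= horner_morphX.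
  + by rewrite /= horner_morphC hX.
Qed.

(** * Connected components and curves through a point *)

Section LocalizationTheory.
Variables (A : comPzRingType) (x : Spec A).
Implicit Types (a b s t : A).

Local Notation M := (@localization_maximal_ideal A x).
Local Notation den1 := (denominator1 x).
Local Notation frac := Defs.frac.

Definition to_localization a : localization x := frac a den1.

Lemma to_localization_is_zmod_morphism : zmod_morphism to_localization.
Proof.
move=> a b; apply/esym; rewrite /to_localization fracB_subproof.
by apply: eq_frac => /=; ring.
Qed.

Lemma to_localization_is_monoid_morphism : monoid_morphism to_localization.
Proof.
split=> // a b; rewrite [RHS](_ : _ = mull (to_localization a) (to_localization b))//.
by rewrite mullE; apply: eq_frac => /=; ring.
Qed.

HB.instance Definition _ := GRing.isZmodMorphism.Build A (localization x)
  to_localization to_localization_is_zmod_morphism.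
HB.instance Definition _ := GRing.isMonoidMorphism.Build A (localization x)
  to_localization to_localization_is_monoid_morphism.

Lemma frac_mul_denominator a (s : denominator x) :
  frac a s * to_localization (sval s) = to_localization a.
Proof.
rewrite [LHS](_ : _ = mull (frac a s) (to_localization (sval s)))// mullE.
by apply: eq_frac => /=; ring.
Qed.

Definition to_denominator s (xs : ~ prime_of x s) : denominator x :=
  exist _ s (introN idP (fun sx => xs (set_mem sx))).

Lemma to_localization_eq0 a :
  to_localization a = 0 <-> saturation x [set 0] a.
Proof.
rewrite [0](_ : _ = frac 0 den1)// frac_eqP; split=> [[u]|[s xs /= sa]].
  by rewrite /= mul0r mulr0 mulr1 => ua; exists (sval u) => //; apply: denominatorP.
by exists (to_denominator xs); rewrite /= mul0r mulr0 mulr1.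
Qed.

Lemma localization_maximal_ideal_prime : prime_ideal M.
Proof.
have [[x0 xD xM] x1 xP] := prime_ofP x.
split.
- split.
  + by apply/(localization_maximal_idealE 0 den1).
  + elim/fracW=> a s; elim/fracW=> b t /localization_maximal_idealE xa.
    move=> /localization_maximal_idealE xb.
    rewrite [frac a s + _](_ : _ = addl (frac a s) (frac b t))// addlE.
    by apply/localization_maximal_idealE; apply: xD; rewrite mulrC; apply: xM.
  + elim/fracW=> a s; elim/fracW=> b t /localization_maximal_idealE xb.
    rewrite [frac a s * _](_ : _ = mull (frac a s) (frac b t))// mullE.
    by apply/localization_maximal_idealE; apply: xM.
- by rewrite [1](_ : _ = frac 1 den1)// localization_maximal_idealE.
- elim/fracW=> a s; elim/fracW=> b t.
  rewrite [frac a s * _](_ : _ = mull (frac a s) (frac b t))// mullE.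
  by rewrite !localization_maximal_idealE; apply: xP.
Qed.

Lemma localization_unit (f : localization x) : ~ M f -> exists g, g * f = 1.
Proof.
elim/fracW: f => a s; rewrite localization_maximal_idealE => xa.
exists (frac (sval s) (to_denominator xa)).
rewrite [_ * _](_ : _ = mull (frac (sval s) (to_denominator xa)) (frac a s))// mullE.
by rewrite [1](_ : _ = frac 1 den1)//; apply: eq_frac => /=; ring.
Qed.

Lemma localization_proper_sub I : ideal I -> ~ I 1 -> I `<=` M.
Proof.
move=> [_ _ IM] I1 f If; apply: contrapT => /localization_unit[g gf].
by apply: I1; rewrite -gf; apply: IM.
Qed.

Lemma localization_maximal_ideal_maximal : maximal_ideal M.
Proof.
have [iM M1 _] := localization_maximal_ideal_prime.
split=> // [MT|J iJ MJ]; first by apply: M1; rewrite MT.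
have [J1|J1] := EM (J 1); [right|left].
  by apply/seteqP; split=> // f _; apply: ideal_total.
by apply/seteqP; split=> //; apply: localization_proper_sub.
Qed.

End LocalizationTheory.

Lemma zero_ideal (A : comPzRingType) : ideal [set 0 : A].
Proof.
by split=> // [a b -> ->|a b ->]; rewrite /= ?addr0 ?mulr0.
Qed.

Lemma ideal_generatedE (A : comPzRingType) (s : seq A) :
  ideal_generated s = adjoin_seq [set 0] s.
Proof.
apply/seteqP; split.
  apply: ideal_generated_sub; first by apply: adjoin_seq_ideal; apply: zero_ideal.
  by move=> a sa; apply: adjoin_seq_mem => //; apply: zero_ideal.
have iJ := ideal_generated_ideal s.
apply: adjoin_seq_sub => // [_ ->|a sa]; first by case: iJ.
exact: ideal_generated_mem.
Qed.

(** This puts regularity in the form that [regular_prime] takes. The top of a longest chain is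
    enlarged to the maximal ideal. *)
Lemma regular_localization (A : comPzRingType) (x : Spec A) :
  regular_local_ring (localization x) ->
  noetherian (localization x) /\
  exists2 xs, adjoin_seq [set 0] xs = @localization_maximal_ideal A x &
    chain_above [set 0] (size xs) (@localization_maximal_ideal A x).
Proof.
move=> [noethB [m [_ mM [d [[P [pP Plt]] _] [[xs sxs xsm] _]]]]]; split=> //.
rewrite -(mM _ (localization_maximal_ideal_maximal x)) in xsm.
exists xs; first by rewrite -ideal_generatedE.
rewrite sxs; have cP i (id : (i < d.+1)%N) : chain_above [set 0] i (P (Ordinal id)).
  elim: i => [|i IHi] in id *.
    by apply: chain_above0 => // _ ->; have [[]] := pP (Ordinal id).
  by apply: (chain_aboveS (IHi (ltnW id))) => //; apply: Plt => /=.
apply: (chain_above_widen (cP d (ltnSn d))); first exact: localization_maximal_ideal_prime.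
by have [iP P1 _] := pP (Ordinal (ltnSn d)); apply: localization_proper_sub.
Qed.

Section RegularPoints.
Variable A : comPzRingType.
Implicit Types (x y : Spec A) (a b s t : A).

(** The kernel of [A -> A_x], by [to_localization_eq0]. *)
Local Notation ker x := (saturation (prime_of x) [set 0 : A]).
Local Notation frac := Defs.frac.

Lemma regular_ker_prime x : regular_local_ring (localization x) -> prime_ideal (ker x).
Proof.
move=> /regular_localization[noethB [xs xsM cM]].
have [_ n1 P0] : prime_ideal [set 0 : localization x].
  apply: regular_prime xsM cM => //; last exact: zero_ideal.
    exact: localization_maximal_ideal_prime.
  exact: localization_unit.
split.
- apply: saturation_ideal; [exact: prime_ofP|exact: zero_ideal].
- by move=> /to_localization_eq0; rewrite rmorph1.
- move=> a b /to_localization_eq0; rewrite rmorphM => /P0[] /to_localization_eq0.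
    by left.
  by right.
Qed.

(* The subscheme cut out by [K] is, near [x], a regular curve with parameter [t]
   on which [a] does not vanish identically. *)
Lemma exists_curve x a : regular_local_ring (localization x) -> ~ ker x a -> prime_of x a ->
  exists K t, [/\ prime_ideal K /\ K `<=` prime_of x, ~ K a, ~ K t, prime_of x t &
    forall b, prime_of x b -> exists2 s, ~ prime_of x s & adjoin K t (s * b)].
Proof.
move=> /regular_localization[noethB [xs xsM cM]] xa0 xa.
have pM := localization_maximal_ideal_prime x.
have xs0 : xs != [::].
  apply/eqP => xs0; apply: xa0; apply/to_localization_eq0.
  suff : localization_maximal_ideal (to_localization x a) by rewrite -xsM xs0.
  exact/localization_maximal_idealE.
have [|K [f [pK Ka Kf KfM]]] := exists_transversal_prime noethB pM
    (@localization_unit _ x) (zero_ideal _) xsM cM xs0 (a := to_localization x a).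
  by move=> /to_localization_eq0.
have [[K0 KD KM] K1 KP] := pK.
have KsubM : K `<=` @localization_maximal_ideal A x.
  by rewrite -KfM; apply: sub_adjoin.
have Ks (s : denominator x) : ~ K (to_localization x (sval s)).
  by move=> /KsubM/localization_maximal_idealE; apply: denominatorP.
move: Kf KfM; elim/fracW: f => t s Kf KfM.
(* The curve is pulled back to [A]. The numerator [t] of the parameter is again a parameter, since
   denominators are units of [A_x]. *)
exists (to_localization x @^-1` K), t; split=> //.
- split=> [|b /KsubM/localization_maximal_idealE //].
  split=> [||b c] /=; last 2 first.
  + by rewrite rmorph1.
  + by rewrite rmorphM; apply: KP.
  split=> [|b c Kb Kc|b c Kc] /=; rewrite ?(rmorph0, rmorphD, rmorphM)//.
    exact: KD.
  exact: KM.
- by rewrite /= -(frac_mul_denominator t s) => /KP[//|/Ks].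
- apply/(localization_maximal_idealE t s); rewrite -KfM; apply: adjoin_mem.
  by case: pK.
- move=> b xb; have : localization_maximal_ideal (to_localization x b).
    exact/localization_maximal_idealE.
  rewrite -KfM => -[g]; elim/fracW: g => c r Kb.
  exists (sval (denominatorM s r)); first exact: denominatorP.
  exists c; rewrite /preimage /mkset rmorphB !rmorphM /=.
  rewrite -(frac_mul_denominator t s) -(frac_mul_denominator c r).
  set u := to_localization x _; set v := to_localization x _.
  rewrite (_ : _ - _ = u * v * (to_localization x b - frac c r * frac t s)); last by ring.
  exact: KM.
Qed.

Lemma ker_sub x : ker x `<=` prime_of x.
Proof.
have [[x0 _ _] _ xP] := prime_ofP x.
by move=> a [s xs sa]; have [|//|//] := xP s a; rewrite sa.
Qed.

Hypothesis noethA : noetherian A.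
Hypothesis regA : forall x, regular_local_ring (localization x).

(** A regular point lies on one irreducible component only. If [s * a = 0] with [s] outside [x], the
    prime [ker y] contains [a] or [s]; in the latter case [t * s = 0] with [t] outside [y], and
    [ker x] would contain [t] or [s], both impossible. *)
Lemma ker_eq x y : ker x `<=` prime_of y -> ker x `<=` ker y.
Proof.
have [[x0 _ _] _ xP] := regular_ker_prime (regA x).
have [[y0 _ _] _ yP] := regular_ker_prime (regA y).
move=> xy a [s xs sa]; have [|[t yt ts]|//] := yP s a; first by rewrite sa.
case: xs; apply: ker_sub; have [|/xy//|//] := xP t s.
by rewrite ts.
Qed.

(** At a point [y] of this locus, [ker x] vanishes in [A_y]. Being finitely generated, it is killed
    by one [e] that is nonzero at [y], and the locus contains every point where [e] is nonzero. *)
Lemma open_vanishing_ker x : open (vanishing_locus (ker x)).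
Proof.
exists [set e | forall z, ~ prime_of z e -> vanishing_locus (ker x) z].
apply/seteqP; split=> y /=; last first.
  by move=> /existsNP[e /not_implyP[eE ye]]; apply: eE.
move=> /ker_eq xy.
have iker : ideal (ker x) by have [] := regular_ker_prime (regA x).
have [e ye ex] := saturation_uniform noethA (prime_ofP y) (@zero_ideal A) iker xy.
move=> /(_ e) Ey; apply: ye; apply: Ey.
move=> z ze a /ex ea; have [[z0 _ _] _ zP] := prime_ofP z.
by have [|//|//] := zP e a; rewrite ea.
Qed.

Lemma component_not_ker x y a :
  connected_component setT x y -> ~ prime_of x a -> ~ ker y a.
Proof.
move=> [C [Cx _ connC] Cy] xa ya; apply: xa; apply: ker_sub.
apply: (@ker_eq y x) ya.
have Vy : vanishing_locus (ker y) y by apply: ker_sub.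
(* The locus of [ker y] is open and closed, so it contains the connected set [C] through [y]. *)
have /seteqP[_ /(_ x Cx)[]//] : C `&` vanishing_locus (ker y) = C.
apply: connC.
- by exists y.
- by exists (vanishing_locus (ker y)) => //; apply: open_vanishing_ker.
- exists (vanishing_locus (ker y)) => //; rewrite -[vanishing_locus _]setCK.
  by apply: open_closedC; exists (ker y).
Qed.

End RegularPoints.

(** * Real points of curves *)

HB.instance Definition _ (R : realType) (m n : nat) := Complete.on 'M[R]_(m, n).

Section FixedPoint.
Variables (R : realType) (n : nat).
Implicit Types y z : 'rV[R]_n.+1.

Lemma normr_rV_le z c : 0 <= c -> (forall i, `|z 0 i| <= c) -> `|z| <= c.
Proof.
move=> c0 zc; rewrite /Num.norm /= mx_normrE.
by apply/bigmax_leP; split=> // -[i j] _; rewrite ord1.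
Qed.

Lemma normr_coord_le z i : `|z 0 i| <= `|z|.
Proof.
rewrite [in leRHS]/Num.norm /= mx_normrE.
exact: (le_bigmax _ (fun ij => `|z ij.1 ij.2|) (0, i)).
Qed.

Lemma exists_fixed_point (Phi : 'rV[R]_n.+1 -> 'rV[R]_n.+1) (r : R) : 0 < r ->
  (forall z, `|z| <= r -> `|Phi z| <= r) ->
  (forall y z, `|y| <= r -> `|z| <= r -> `|Phi y - Phi z| <= 2^-1 * `|y - z|) ->
  exists2 z, `|z| <= r & Phi z = z.
Proof.
move=> r0 Phir Phi_contr.
pose U := closed_ball (0 : 'rV[R]_n.+1) r.
have UE z : U z <-> `|z| <= r.
  by rewrite /U closed_ballE// /closed_ball_ /= sub0r normrN.
have PhiU : {homo Phi : z / U z} by move=> z /UE/Phir/UE.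
pose f : {fun U >-> U} := HB.pack Phi (isFun.Build _ _ U U Phi PhiU).
have cU : closed U by exact: closed_ball_closed.
have [||z /UE zr zf] := @banach_fixed_point R _ U f _ cU.
- exists (2^-1)%:nng; split=> /=; first by rewrite invf_lt1// ltr1n.
  by move=> [y z] [/= /UE yr /UE zr]; apply: Phi_contr.
- by exists 0; apply/UE; rewrite normr0 ltW.
- by exists z.
Qed.

End FixedPoint.

(** * Lipschitz estimates for polynomial functions *)

Section PolynomialFunctions.
Variables (R : realType) (n : nat) (F : comNzRingType) (iota : {rmorphism R -> F}).
Variables (X : nat -> F) (ev : 'rV[R]_n.+1 -> {rmorphism F -> R}).
Hypothesis genF : forall S, subalgebra iota S -> (forall i, (i < n.+1)%N -> S (X i)) ->
  S = setT.
Hypothesis ev_iota : forall y c, ev y (iota c) = c.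
Hypothesis ev_X : forall y i, (i < n.+1)%N -> ev y (X i) = y 0 (inord i).
Implicit Types (y z : 'rV[R]_n.+1) (g : F).

(** The functions with this property form a subalgebra that contains the coordinates; for products,
    boundedness on the unit ball is used. *)
Lemma ev_lipschitz g : exists2 C, 0 <= C &
  forall y z, `|y| <= 1 -> `|z| <= 1 -> `|ev y g - ev z g| <= C * `|y - z|.
Proof.
pose S := [set g | exists2 C, 0 <= C &
  forall y z, `|y| <= 1 -> `|z| <= 1 -> `|ev y g - ev z g| <= C * `|y - z|].
suff /seteqP[_ /(_ g)] : S = setT by apply.
apply: genF => [|i ni]; last first.
  exists 1 => // y z _ _; rewrite !ev_X// mul1r.
  by have := normr_coord_le (y - z) (inord i); rewrite !mxE.
split=> [c|a b [C C0 Ca] [D D0 Db]|a b [C C0 Ca] [D D0 Db]].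
- by exists 0 => // y z _ _; rewrite !ev_iota subrr normr0 mul0r.
- exists (C + D); first exact: addr_ge0.
  move=> y z y1 z1; rewrite !rmorphB mulrDl.
  rewrite [leLHS](_ : _ = `|(ev y a - ev z a) - (ev y b - ev z b)|); last first.
    by congr `|_|; ring.
  by apply: le_trans (ler_normB _ _) _; apply: lerD; [apply: Ca|apply: Db].
- have bound g' E : 0 <= E ->
      (forall y z, `|y| <= 1 -> `|z| <= 1 -> `|ev y g' - ev z g'| <= E * `|y - z|) ->
      forall y, `|y| <= 1 -> `|ev y g'| <= `|ev 0 g'| + E.
    move=> E0 Eg y y1; rewrite -[ev y g'](subrKC (ev 0 g')).
    apply: le_trans (ler_normD _ _) _; rewrite lerD2l.
    apply: le_trans (Eg _ _ y1 _) _; first by rewrite normr0.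
    by rewrite subr0 ler_piMr.
  exists ((`|ev 0 a| + C) * D + (`|ev 0 b| + D) * C).
    by rewrite addr_ge0// mulr_ge0// addr_ge0.
  move=> y z y1 z1; rewrite !rmorphM.
  rewrite [leLHS](_ : _ = `|ev y a * (ev y b - ev z b) + ev z b * (ev y a - ev z a)|); last first.
    by congr `|_|; ring.
  apply: le_trans (ler_normD _ _) _; rewrite !normrM mulrDl -!mulrA.
  by apply: lerD; apply: ler_pM => //; [apply: bound|apply: Db|apply: bound|apply: Ca].
Qed.

Lemma ev_neq0_near g : ev 0 g != 0 ->
  exists2 d, 0 < d & forall y, `|y| <= d -> ev y g != 0.
Proof.
move=> g0; have [C C0 Cg] := ev_lipschitz g.
(* Within this radius [g] moves by at most half of [|ev 0 g|]; [C + 1] avoids a division by zero. *)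
pose d := Num.min 1 (`|ev 0 g| / (2 * (C + 1))).
have gt0 : 0 < `|ev 0 g| by rewrite normr_gt0.
have C1 : 0 < C + 1 by rewrite ltr_wpDl.
exists d; first by rewrite lt_min ltr01 divr_gt0// mulr_gt0.
move=> y; rewrite le_min => /andP[y1 yd]; apply/eqP => yg0.
have := Cg y 0 y1; rewrite normr0 ler01 yg0 sub0r normrN subr0 => /(_ isT).
move: yd; rewrite ler_pdivlMr ?mulr_gt0// => yd gC.
have y0 := normr_ge0 y.
by nra.
Qed.

(** A product of two functions that vanish at the origin has order two there, so its Lipschitz
    constant on a ball shrinks with the radius. *)
Lemma ev_mul_lipschitz a b : ev 0 a = 0 -> ev 0 b = 0 -> exists2 C, 0 <= C &
  forall r y z, r <= 1 -> `|y| <= r -> `|z| <= r ->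
    `|ev y (a * b) - ev z (a * b)| <= C * r * `|y - z|.
Proof.
move=> a0 b0; have [C C0 Ca] := ev_lipschitz a; have [D D0 Db] := ev_lipschitz b.
have bound g E : ev 0 g = 0 ->
    (forall y z, `|y| <= 1 -> `|z| <= 1 -> `|ev y g - ev z g| <= E * `|y - z|) ->
    forall y, `|y| <= 1 -> `|ev y g| <= E * `|y|.
  by move=> g0 Eg y y1; have := Eg y 0 y1; rewrite normr0 ler01 g0 !subr0; apply.
exists (C * D + D * C); first by rewrite addr_ge0// mulr_ge0.
move=> r y z r1 yr zr; rewrite !rmorphM.
have y1 := le_trans yr r1; have z1 := le_trans zr r1.
rewrite [leLHS](_ : _ = `|ev y a * (ev y b - ev z b) + ev z b * (ev y a - ev z a)|); last first.
  by congr `|_|; ring.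
apply: le_trans (ler_normD _ _) _; rewrite !normrM.
rewrite (_ : _ * r * _ = (C * r) * (D * `|y - z|) + (D * r) * (C * `|y - z|)); last by ring.
apply: lerD; apply: ler_pM => //; [|exact: Db| |exact: Ca].
  by apply: le_trans (bound _ _ a0 Ca _ y1) _; apply: ler_wpM2l.
by apply: le_trans (bound _ _ b0 Db _ z1) _; apply: ler_wpM2l.
Qed.

(** The equation [u j * X j.+1 = h j * X 0] is rewritten as [X j.+1 = q j] with [q j] of order two
    at the origin. The map with coordinates [r] and the [q j] is then a contraction of a small
    ball. *)
Lemma exists_curve_point (u h : nat -> F) : (forall j, ev 0 (u j) = 1) ->
  (forall j, ev 0 (h j) = 0) ->
  exists2 d, 0 < d & forall r, 0 < r -> r <= d -> exists z, [/\ `|z| <= r,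
    ev z (X 0) = r & forall j, (j < n)%N -> ev z (u j * X j.+1 - h j * X 0) = 0].
Proof.
move=> u1 h0.
have ev0X i : (i < n.+1)%N -> ev 0 (X i) = 0 by move=> ni; rewrite ev_X// mxE.
pose q j := (1 - u j) * X j.+1 + h j * X 0.
have qC j : exists C, (j < n)%N -> 0 <= C /\ forall r y z,
    r <= 1 -> `|y| <= r -> `|z| <= r -> `|ev y (q j) - ev z (q j)| <= C * r * `|y - z|.
  have [jn|jn] := ltnP j n; last by exists 0.
  have [|C C0 Cu] := @ev_mul_lipschitz (1 - u j) (X j.+1) _ (ev0X j.+1 jn).
    by rewrite rmorphB rmorph1 u1 subrr.
  have [D D0 Dh] := ev_mul_lipschitz (h0 j) (ev0X 0%N isT).
  exists (C + D) => _; split=> [|r y z r1 yr zr]; first exact: addr_ge0.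
  rewrite !rmorphD [leLHS](_ : _ = `|(ev y ((1 - u j) * X j.+1) - ev z ((1 - u j) * X j.+1))
    + (ev y (h j * X 0) - ev z (h j * X 0))|); last by congr `|_|; ring.
  apply: le_trans (ler_normD _ _) _; rewrite -mulrA [leRHS]mulrDl !mulrA.
  by apply: lerD; [apply: Cu|apply: Dh].
have [C {}qC] := choice qC.
(* [E] bounds all the constants [C j], and [d] makes [E * r] at most one half. *)
pose E := \sum_(j < n) C j.
have E0 : 0 <= E by apply: sumr_ge0 => j _; have [] := qC j (ltn_ord j).
have CE j : (j < n)%N -> C j <= E.
  move=> jn; rewrite /E (bigD1 (Ordinal jn))//= lerDl.
  by apply: sumr_ge0 => i _; have [] := qC i (ltn_ord i).
have E1 : 0 < E + 1 by rewrite ltr_wpDl.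
pose d := Num.min 1 ((2 * (E + 1))^-1).
exists d; first by rewrite lt_min ltr01 invr_gt0 mulr_gt0.
move=> r r0; rewrite le_min => /andP[r1 rE].
have Er : E * r <= 2^-1.
  move: rE; rewrite -[_^-1]mul1r ler_pdivlMr ?mulr_gt0// => rE.
  by nra.
pose Phi z : 'rV[R]_n.+1 :=
  \row_(i < n.+1) if i is Ordinal j.+1 _ then ev z (q j) else r.
have Phi0 z : Phi z 0 (inord 0) = r.
  by rewrite mxE; have := @inordK n 0 isT; case: (inord 0) => -[].
have PhiS z j : (j < n)%N -> Phi z 0 (inord j.+1) = ev z (q j).
  move=> jn; rewrite mxE; have : (inord j.+1 : 'I_n.+1) = j.+1 :> nat by rewrite inordK.
  by case: (inord j.+1) => -[//|i] /= _ [->].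
have ord_cases (i : 'I_n.+1) : i = inord 0 \/ exists2 j, (j < n)%N & i = inord j.+1.
  case: i => -[|j] jn; [left|right; exists j => //]; apply/val_inj => /=;
  by rewrite inordK.
have q_lip j y z : (j < n)%N -> `|y| <= r -> `|z| <= r ->
    `|ev y (q j) - ev z (q j)| <= 2^-1 * `|y - z|.
  move=> jn yr zr; have [_ qj] := qC j jn; apply: le_trans (qj r y z r1 yr zr) _.
  apply: ler_wpM2r => //; apply: le_trans Er; apply: ler_wpM2r; first exact: ltW.
  exact: CE.
have [||z zr zfix] := @exists_fixed_point R n Phi r r0.
- move=> z zr; apply: normr_rV_le; first exact: ltW.
  move=> i; have [->|[j jn ->]] := ord_cases i.
    by rewrite Phi0 ger0_norm// ltW.
  have := q_lip j z 0 jn zr; rewrite normr0 (ltW r0) PhiS// => /(_ isT).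
  rewrite (_ : ev 0 (q j) = 0) ?subr0; last first.
    by rewrite rmorphD !rmorphM (ev0X 0%N)// (ev0X j.+1)// !mulr0 addr0.
  have := normr_ge0 z; lra.
- move=> y z yr zr; apply: normr_rV_le; first by rewrite mulr_ge0.
  move=> i; rewrite mxE [X in _ + X]mxE.
  have [->|[j jn ->]] := ord_cases i.
    by rewrite !Phi0 subrr normr0 mulr_ge0.
  by rewrite !PhiS//; apply: q_lip.
exists z; split=> // [|j jn].
  by rewrite ev_X// -zfix Phi0.
have /esym : Phi z 0 (inord j.+1) = z 0 (inord j.+1) by rewrite zfix.
rewrite PhiS// -ev_X// => /eqP; rewrite -subr_eq0 -rmorphB => /eqP zq.
by rewrite -[RHS]zq; congr (ev z _); rewrite /q; ring.
Qed.

End PolynomialFunctions.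

Lemma rmorphism_factor (F A B : comPzRingType) (p : {rmorphism F -> A})
    (e : {rmorphism F -> B}) :
  (forall a, exists g, p g = a) -> (forall g, p g = 0 -> e g = 0) ->
  exists f : {rmorphism A -> B}, forall g, f (p g) = e g.
Proof.
move=> /choice[l pl] pe; pose f a := e (l a).
have fE g : f (p g) = e g.
  apply/eqP; rewrite -subr_eq0 -rmorphB; apply/eqP/pe.
  by rewrite rmorphB pl subrr.
have fB : zmod_morphism f by move=> a b; rewrite -(pl a) -(pl b) -rmorphB !fE rmorphB.
have fM : monoid_morphism f.
  split=> [|a b]; first by rewrite -(rmorph1 p) fE rmorph1.
  by rewrite -(pl a) -(pl b) -rmorphM !fE rmorphM.
pose f' : {rmorphism A -> B} := HB.pack f
  (GRing.isZmodMorphism.Build A B f fB) (GRing.isMonoidMorphism.Build A B f fM).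
by exists f'.
Qed.

Lemma kernel_prime (A : comPzRingType) (B : idomainType) (f : {rmorphism A -> B}) :
  prime_ideal [set a | f a = 0].
Proof.
split=> [||a b /=].
- split=> [|a b /= a0 b0|a b /= b0]; rewrite /= ?rmorph0//.
    by rewrite rmorphD a0 b0 addr0.
  by rewrite rmorphM b0 mulr0.
- by rewrite /= rmorph1 => /eqP; rewrite oner_eq0.
- by rewrite rmorphM => /eqP; rewrite mulf_eq0 => /orP[]/eqP; [left|right].
Qed.

(** * Real points on a curve near a regular real point *)

Section CurvePoint.
Variables (R : realType) (A : comNzRingType) (phi : {rmorphism R -> A}).
Variables (f : {rmorphism A -> R}) (K : set A) (t : A).
Hypothesis f_phi : forall c, f (phi c) = c.
Hypothesis prime_K : prime_ideal K.
Hypothesis K_sub : forall b, K b -> f b = 0.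
Hypothesis Kt : ~ K t.
Hypothesis ft : f t = 0.
Hypothesis curve_f : forall b, f b = 0 -> exists2 s, f s <> 0 & adjoin K t (s * b).

(* After subtracting its linear part in [t], the coordinate function [b - phi (f b)]
   lies in [K] plus [t] times the maximal ideal, up to a unit. *)
Lemma exists_linearization (b : A) : exists c sc : A * A,
  [/\ b = c.1 + phi (f b) + c.2 * t, exists r, c.2 = phi r,
      f c.1 = 0, f sc.1 = 1 /\ f sc.2 = 0 & K (sc.1 * c.1 - sc.2 * t)].
Proof.
have [|s fs [c Kc]] := curve_f (b := b - phi (f b)).
  by rewrite rmorphB f_phi subrr.
(* [r] is the derivative of [b] along the curve with respect to [t]. *)
move/eqP: fs => fs; pose r := f c / f s; have [[_ _ KM] _ _] := prime_K.
exists (b - phi (f b) - phi r * t, phi r).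
exists (phi (f s)^-1 * s, phi (f s)^-1 * (c - phi r * s)) => /=; split.
- by ring.
- by exists r.
- by rewrite !rmorphB rmorphM !f_phi ft mulr0 subrr subr0.
- rewrite !rmorphM !rmorphB !rmorphM !f_phi mulVf//; split=> //.
  by rewrite /r divfK// subrr mulr0.
- rewrite (_ : _ - _ = phi (f s)^-1 * (s * (b - phi (f b)) - c * t)); last by ring.
  exact: KM.
Qed.

(** The polynomial ring [F] maps onto [A], the variables going to [t] and the corrected generators,
    and [f] becomes the origin. Near the origin the equations [w j] alone cut out the curve, so
    their small zeros are real points of [Spec A]. *)
Lemma exists_curve_point_avoiding (a : A) :
  finitely_generated_algebra phi -> ~ K a ->
  exists2 g : {rmorphism A -> R}, (forall c, g (phi c) = c) & g a <> 0.
Proof.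
move=> [s sA] Ka; pose n := size s; have [iK K1 KP] := prime_K.
have [K0 KD KM] := iK.
have [S] := choice (fun j => exists_linearization s`_j) => /choice[U SU].
have [F [iota [X [noethF genF univF]]]] := exists_free_algebra R n.+1.
have [p [p_iota pX]] := univF A phi (fun i => if i is j.+1 then (S j).1 else t).
have pt : p (X 0) = t by apply: (pX 0%N).
have pS j : (j < n)%N -> p (X j.+1) = (S j).1 by move=> jn; apply: (pX j.+1).
have psurj b : exists g, p g = b.
  suff : setT `<=` range p by move=> /(_ b I)[g _ gb]; exists g.
  rewrite -sA; apply: smallest_sub => [|c /= /(nthP 0)[j jn <-]].
    split=> [c|_ _ [g _ <-] [g' _ <-]|_ _ [g _ <-] [g' _ <-]].
    - by exists (iota c).
    - by exists (g - g'); rewrite ?rmorphB.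
    - by exists (g * g'); rewrite ?rmorphM.
  have [-> [r ->] _ _ _] := SU j.
  (* The variable [X 0] restores the linear term that was subtracted from the generator. *)
  exists (X j.+1 + iota (f s`_j) + iota r * X 0) => //.
  by rewrite !rmorphD rmorphM !p_iota pt pS.
have [ev evP] := choice (fun y : 'rV[R]_n.+1 => univF R idfun (fun i => y 0 (inord i))).
have ev_iota y c : ev y (iota c) = c by have [-> _] := evP y.
have ev_X y i : (i < n.+1)%N -> ev y (X i) = y 0 (inord i) by move=> /(evP y).2.
have ev0 g : ev 0 g = f (p g).
  suff /seteqP[_ /(_ g)] : [set g | ev 0 g = f (p g)] = setT by apply.
  apply: genF => [|[|j] jn] /=; last 2 first.
  - by rewrite ev_X// mxE pt ft.
  - by rewrite ev_X// mxE pS//; have [_ _ ->] := SU j.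
  split=> [c|b c /= bE cE|b c /= bE cE] /=.
  - by rewrite ev_iota p_iota f_phi.
  - by rewrite !rmorphB bE cE.
  - by rewrite !rmorphM bE cE.
have [u pu] := choice (fun j => psurj (U j).1).
have [h ph] := choice (fun j => psurj (U j).2).
have u1 j : ev 0 (u j) = 1 by rewrite ev0 pu; have [_ _ _ []] := SU j.
have h0 j : ev 0 (h j) = 0 by rewrite ev0 ph; have [_ _ _ []] := SU j.
pose P := [set g | ev 0 g = 0].
have pP : prime_ideal P := kernel_prime (ev 0).
pose w j := u j * X j.+1 - h j * X 0.
pose J := ideal_generated (mkseq w n).
have iJ : ideal J := ideal_generated_ideal _.
have JK g : J g -> K (p g).
  apply: (@ideal_generated_sub _ (mkseq w n) [set g | K (p g)]).
    split=> [|b c /= Kb Kc|b c /= Kc] /=; rewrite ?rmorph0//.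
      by rewrite rmorphD; apply: KD.
    by rewrite rmorphM; apply: KM.
  move=> _ /mapP[j + ->]; rewrite mem_iota => /= jn.
  by rewrite /= rmorphB !rmorphM pu ph pt pS//; have [] := SU j.
have PK b : K (p b) -> P b by move=> Kb; rewrite /P /= ev0 K_sub.
pose L := saturation P J.
have iL : ideal L by apply: saturation_ideal.
have sL : saturated P L by apply: saturation_saturated.
have iLX : ideal (adjoin L (X 0)) by apply: adjoin_ideal.
pose N := saturation P (adjoin L (X 0)).
have iN : ideal N by apply: saturation_ideal.
(* In the local ring at the origin modulo the [w j], [X 0] generates the maximal ideal: [w j] makes
   [u j * X j.+1] a multiple of [X 0], and [u j] is a unit. *)
have PN : P `<=` N.
  have [N0 ND NM] := iN.
  suff /seteqP[_ H] : [set g | N (g - iota (ev 0 g))] = setT.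
    by move=> g Pg; have := H g I; rewrite /= [ev 0 g]Pg rmorph0 subr0.
  apply: genF => [|[|j] jn] /=; last 2 first.
  - rewrite ev_X// mxE rmorph0 subr0.
    by apply: sub_saturation => //; apply: adjoin_mem.
  - rewrite ev_X// mxE rmorph0 subr0; exists (u j).
      by rewrite /P /= u1; apply/eqP/oner_neq0.
    exists (h j); apply: sub_saturation => //; apply: ideal_generated_mem.
    by apply/mapP; exists j; rewrite ?mem_iota.
  split=> [c|b c /= Nb Nc|b c /= Nb Nc] /=.
  - by rewrite ev_iota subrr.
  - rewrite !rmorphB (_ : _ - _ = (b - iota (ev 0 b)) - (c - iota (ev 0 c))); last by ring.
    exact: idealB.
  - rewrite !rmorphM (_ : _ - _ = c * (b - iota (ev 0 b))
      + iota (ev 0 b) * (c - iota (ev 0 c))); last by ring.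
    by apply: ND; apply: NM.
(* As in a discrete valuation ring, a quotient [b] of [g] by a power of [X 0] that allows no further
   division is a unit. *)
have expand g : ~ L g -> exists s' v k, [/\ ~ P s', ~ P v & J (s' * g - v * X 0 ^+ k)].
  move=> Lg; pose W := [set b | ~ L b /\
    exists s', ~ P s' /\ exists k, L (s' * g - b * X 0 ^+ k)].
  have [||b [Lb [s' [Ps' [k Lk]]]] bmin] := exists_indecomposable noethF pP iL sL (W := W) (a := g).
  - by apply/seteqP; split=> // b [[Lb _] /Lb].
  - split=> //; exists 1; split; first exact: prime_not1.
    by exists 0%N; rewrite expr0 mulr1 mul1r subrr; case: iL.
  have [LX LD LM] := iL.
  have Pb : ~ P b.
    move=> /PN[s'' Ps'' [c Lc]].
    apply: (bmin s'' (X 0) c) => //; last by rewrite [X 0 * c]mulrC.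
      by rewrite /P /= ev0 pt.
    split.
      move=> Lc'; apply: Lb; apply: sL; exists s'' => //.
      by apply: (idealBl iL Lc); rewrite mulrC; apply: LM.
    exists (s'' * s'); split; first exact: prime_notM.
    exists k.+1; rewrite exprS.
    rewrite (_ : _ - _ = s'' * (s' * g - b * X 0 ^+ k)
      + X 0 ^+ k * (s'' * b - c * X 0)); last by ring.
    by apply: LD; apply: LM.
  have [s'' Ps'' Js] := Lk; exists (s'' * s'), (s'' * b), k.
  split; [exact: prime_notM|exact: prime_notM|].
  by rewrite -!mulrA -mulrBr.
have ikerp : ideal [set g | p g = 0].
  split=> [|b c /= b0 c0|b c /= c0] /=; rewrite ?rmorph0//.
    by rewrite rmorphD b0 c0 addr0.
  by rewrite rmorphM c0 mulr0.
(* An element of the kernel of [p] outside [L] would be a unit times a power of [X 0], whose image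
   is not in [K]. Hence one [e], nonzero at the origin, multiplies the kernel into [J]. *)
have [|e Pe eJ] := saturation_uniform noethF pP iJ ikerp.
  move=> g pg; apply: contrapT => /expand[s' [v [k [_ Pv]]]].
  move=> /JK; rewrite rmorphB !rmorphM pg mulr0 sub0r => /(idealN iK).
  rewrite opprK rmorphXn pt => /KP[/PK//|/(prime_exp prime_K)].
  exact: Kt.
have [g pg] := psurj a.
have [|s' [v [k [_ Pv Jg]]]] := expand g.
  by move=> [s1 Ps1 /JK]; rewrite rmorphM pg => /KP[/PK|].
have [d d0 dP] := exists_curve_point genF ev_iota ev_X u1 h0.
have ev0ev : ev 0 (e * v) != 0 by apply/eqP; apply: (prime_notM pP Pe Pv).
have [d' d'0 d'P] := ev_neq0_near genF ev_iota ev_X ev0ev.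
pose r := Num.min d d'.
have r0 : 0 < r by rewrite lt_min d0.
have [|z [zr zX zw]] := dP r r0; first by rewrite ge_min lexx.
have := d'P z; rewrite (le_trans zr) ?ge_min ?lexx ?orbT// rmorphM mulf_eq0 negb_or.
move=> /(_ isT)/andP[ze zv].
have zJ b : J b -> ev z b = 0.
  apply: (@ideal_generated_sub _ (mkseq w n) [set b | ev z b = 0]).
    by have [] := kernel_prime (ev z).
  by move=> _ /mapP[j + ->]; rewrite mem_iota => /= jn; apply: zw.
(* At [z] the [w j] vanish and [e] does not, so the kernel of [p] vanishes and evaluation at [z]
   factors through [A]. *)
have [|q qE] := rmorphism_factor psurj (e := ev z).
  move=> b /eJ/zJ; rewrite rmorphM => /eqP.
  by rewrite mulf_eq0 (negPf ze) /= => /eqP.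
exists q => [c|]; first by rewrite -p_iota qE ev_iota.
(* If [g] vanished at [z], so would [v * X 0 ^+ k], but [v] is nonzero there and [X 0] is
   [r > 0]. *)
rewrite -pg qE => zg; have := zJ _ Jg.
rewrite rmorphB !rmorphM zg mulr0 sub0r rmorphXn zX => /eqP.
by rewrite oppr_eq0 mulf_eq0 (negPf zv) expf_eq0 (gt_eqF r0) andbF.
Qed.

End CurvePoint.

(** Equality of structures, rather than an isomorphism, lets [A] be replaced everywhere by a ring of
    the type that [exists_free_algebra] takes as target. *)
Lemma comNzRing_of_neq (A : comPzRingType) :
  (1 : A) != 0 -> exists B : comNzRingType, B = A :> comPzRingType.
Proof.
case: A => T c A1; pose A := GRing.ComPzRing.Pack c.
pose B : comNzRingType := HB.pack (GRing.ComPzRing.sort A)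
  (GRing.PzSemiRing_isNonZero.Build A A1).
by exists B; reflexivity.
Qed.

Lemma finitely_generated_noetherian (R : realType) (A : comNzRingType)
    (phi : {rmorphism R -> A}) :
  finitely_generated_algebra phi -> noetherian A.
Proof.
move=> [s sA]; have [F [iota [X [noethF _ univF]]]] := exists_free_algebra R (size s).
have [p [p_iota pX]] := univF A phi (nth 0 s).
apply: (noetherian_surj (f := p)) noethF => b.
suff : setT `<=` range p by move=> /(_ b I)[g _ gb]; exists g.
rewrite -sA; apply: smallest_sub => [|c /= /(nthP 0)[j jn <-]].
  split=> [c|_ _ [g _ <-] [g' _ <-]|_ _ [g _ <-] [g' _ <-]].
  - by exists (iota c).
  - by exists (g - g'); rewrite ?rmorphB.
  - by exists (g * g'); rewrite ?rmorphM.
by exists (X j); rewrite ?pX.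
Qed.

Theorem lemma2p1 (R : realType) (A : comPzRingType) (phi : {rmorphism R -> A})
    (Xsmooth : smooth_affine_variety phi)
    (Xcomponents : no_imaginary_components phi) :
  dense (rational_points phi).
Proof.
move=> O [x Ox] [E OE]; move: Ox; rewrite OE => /existsNP[a /not_implyP[Ea xa]].
have [y [xy [f fphi fy]]] := Xcomponents x.
(* The real point [f] excludes the zero ring. *)
have A1 : (1 : A) != 0.
  by apply/eqP => /(congr1 f)/eqP; rewrite rmorph1 rmorph0 oner_eq0.
have [B EB] := comNzRing_of_neq A1; subst A.
have [finA regA] := Xsmooth.
have ya : ~ saturation y [set 0] a.
  have noethB := finitely_generated_noetherian finA.
  exact: (component_not_ker noethB regA xy xa).
suff [g gphi ga] : exists2 g : {rmorphism B -> R}, (forall c, g (phi c) = c) & g a <> 0.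
  by exists (Build_Spec (kernel_prime g)); split; [move=> /(_ a Ea)|exists g].
(* If [a] is nonzero at [y], the point [y] itself serves; otherwise a curve through [y] is used. *)
have [yPa|nya] := EM (prime_of y a); last first.
  by exists f => // fa; apply: nya; rewrite fy.
have [K [t [[pK Ky] Ka Kt yt curve_y]]] := exists_curve (regA y) ya yPa.
rewrite fy in Ky yt curve_y.
exact: exists_curve_point_avoiding fphi pK Ky Kt yt curve_y a finA Ka.
Qed.
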